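(* Let $k$ be a field and let $A$ be a dg algebra over $k$ which is coconnective (i.e. $H^{i}(A)=0$ for $i<0$), with $H^0(A)=k$ and with $H^*(A)$ bounded above. Then $\mathrm{Hom}_A(M,A)\neq 0$ for every $M\in \mathrm{Mod}_A$ such that $H^*(M)\neq 0$ and $H^*(M)$ is bounded below.
   Context: Cohomological grading is used throughout. $\mathrm{Mod}_A$ denotes the dg (derived) category of unbounded right dg $A$-modules, and $\mathrm{Hom}_A$ denotes the derived Hom complex; $\mathrm{Hom}_A(M,A)\ne 0$ means that this complex is not acyclic. *)

(* Defs.v *)
From HB Require Import structures.
From mathcomp Require Import all_boot all_order all_algebra.

Set Implicit Arguments.
Unset Strict Implicit.
Unset Printing Implicit Defensive.

Import Order.TTheory GRing.Theory Num.Theory.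
Local Open Scope ring_scope.

(* The sign (-1)^i, to be used with *~ in an arbitrary abelian group. *)
Definition zsign (i : int) : int := (-1) ^+ `|i|%N.

(* A cochain complex (V^i, d) of abelian groups, presented on its total group
   V = \bigoplus_i V^i: [dg_pr i] is the projection of V onto V^i, so that V^i
   is the set of fixed points of [dg_pr i], and [dg_pr_fin] says that V is the
   direct sum (not the product) of the V^i. *)
Record dgStruct (V : zmodType) := DgStruct {
  dg_pr : int -> {additive V -> V};
  dg_d : {additive V -> V};
  dg_pr_pr : forall i j x, dg_pr i (dg_pr j x) = if i == j then dg_pr j x else 0;
  dg_pr_fin : forall x, exists2 s : seq int, uniq s & x = \sum_(i <- s) dg_pr i x;
  dg_d_pr : forall i x, dg_d (dg_pr i x) = dg_pr (i + 1) (dg_d x);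
  dg_d_d : forall x, dg_d (dg_d x) = 0
}.

Section Cohomology.
Variables (V : zmodType) (S : dgStruct V).

Definition homog (i : int) (x : V) : Prop := dg_pr S i x = x.

Definition cocycle (i : int) (z : V) : Prop := homog i z /\ dg_d S z = 0.

Definition coboundary (i : int) (z : V) : Prop :=
  exists2 y : V, homog (i - 1) y & dg_d S y = z.

(* H^i = 0 *)
Definition Hzero (i : int) : Prop := forall z, cocycle i z -> coboundary i z.

Definition Hbounded_above : Prop := exists b : int, forall i, b < i -> Hzero i.

Definition Hbounded_below : Prop := exists b : int, forall i, i < b -> Hzero i.

(* H^* <> 0 *)
Definition Hnonzero : Prop := exists i, ~ Hzero i.

End Cohomology.

Record dgAlgebra (k : fieldType) := DgAlgebra {
  dga_alg :> algType k;
  dga_dg : dgStruct dga_alg;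
  dga_prZ : forall i (c : k) (x : dga_alg),
    dg_pr dga_dg i (c *: x) = c *: dg_pr dga_dg i x;
  dga_dZ : forall (c : k) (x : dga_alg),
    dg_d dga_dg (c *: x) = c *: dg_d dga_dg x;
  dga_one : homog dga_dg 0 (1 : dga_alg);
  dga_mul : forall i j (x y : dga_alg),
    homog dga_dg i x -> homog dga_dg j y -> homog dga_dg (i + j) (x * y);
  dga_leibniz : forall i (x y : dga_alg), homog dga_dg i x ->
    dg_d dga_dg (x * y) = dg_d dga_dg x * y + (x * dg_d dga_dg y) *~ zsign i
}.

Definition coconnective (k : fieldType) (A : dgAlgebra k) : Prop :=
  forall i : int, i < 0 -> Hzero (dga_dg A) i.

(* H^0(A) = k: the unit map k -> H^0(A), c |-> [c.1], is bijective. *)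
Definition H0_is_base (k : fieldType) (A : dgAlgebra k) : Prop :=
  (forall c : k, coboundary (dga_dg A) 0 (c%:A : A) -> c = 0) /\
  (forall z : A, cocycle (dga_dg A) 0 z ->
     exists c : k, coboundary (dga_dg A) 0 (z - c%:A)).

(* Right dg A-modules. A right A-module is a left module over the converse
   ring A^c: for a : A^c, [a *: x] is x.a. The k-module structure is the one
   induced by k -> A; since k lands in A^0 and is killed by d, the grading and
   the differential are automatically k-linear. *)
Record dgModule (k : fieldType) (A : dgAlgebra k) := DgModule {
  dgm_mod :> lmodType A^c;
  dgm_dg : dgStruct dgm_mod;
  dgm_act : forall i j (x : dgm_mod) (a : A),
    homog dgm_dg i x -> homog (dga_dg A) j a ->
    homog dgm_dg (i + j) ((a : A^c) *: x);
  dgm_leibniz : forall i (x : dgm_mod) (a : A), homog dgm_dg i x ->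
    dg_d dgm_dg ((a : A^c) *: x) =
      (a : A^c) *: dg_d dgm_dg x + ((dg_d (dga_dg A) a : A^c) *: x) *~ zsign i
}.

(* A as a right dg module over itself: on (A^c)^o, [a *: x] is the product
   x * a of A. *)
Section RightRegular.
Variables (k : fieldType) (A : dgAlgebra k).

Definition right_regular_dg : dgStruct ((A^c)^o) := dga_dg A.

Fact right_regular_act i j (x : (A^c)^o) (a : A) :
  homog right_regular_dg i x -> homog (dga_dg A) j a ->
  homog right_regular_dg (i + j) ((a : A^c) *: x).
Proof. exact: dga_mul. Qed.

Fact right_regular_leibniz i (x : (A^c)^o) (a : A) :
  homog right_regular_dg i x ->
  dg_d right_regular_dg ((a : A^c) *: x) =
    (a : A^c) *: dg_d right_regular_dg x
    + ((dg_d (dga_dg A) a : A^c) *: x) *~ zsign i.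
Proof. exact: dga_leibniz. Qed.

Definition right_regular : dgModule A :=
  DgModule right_regular_act right_regular_leibniz.

End RightRegular.

Section DerivedHom.
Variables (k : fieldType) (A : dgAlgebra k).

(* The (underived) Hom complex of right dg modules: Hom^n(M, N) consists of the
   A-linear maps f of degree n, with D f = d f - (-1)^n f d. *)
Section HomComplex.
Variables M N : dgModule A.

Definition hom_deg (n : int) (f : {linear M -> N}) : Prop :=
  forall i x, homog (dgm_dg M) i x -> homog (dgm_dg N) (i + n) (f x).

Definition hom_d (n : int) (f : M -> N) (x : M) : N :=
  dg_d (dgm_dg N) (f x) - f (dg_d (dgm_dg M) x) *~ zsign n.

Definition hom_acyclic : Prop :=
  forall (n : int) (f : {linear M -> N}),
    hom_deg n f -> (forall x, hom_d n f x = 0) ->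
    exists2 h : {linear M -> N}, hom_deg (n - 1) h &
      forall x, hom_d (n - 1) h x = f x.

Definition chain_map (f : {linear M -> N}) : Prop :=
  hom_deg 0 f /\ forall x, hom_d 0 f x = 0.

Definition quasi_iso (f : {linear M -> N}) : Prop :=
  [/\ chain_map f,
      forall i z, cocycle (dgm_dg M) i z ->
        coboundary (dgm_dg N) i (f z) -> coboundary (dgm_dg M) i z &
      forall i w, cocycle (dgm_dg N) i w ->
        exists2 z, cocycle (dgm_dg M) i z & coboundary (dgm_dg N) i (w - f z)].

End HomComplex.

Definition acyclic (N : dgModule A) : Prop := forall i, Hzero (dgm_dg N) i.

Definition K_projective (P : dgModule A) : Prop :=
  forall N : dgModule A, acyclic N -> hom_acyclic P N.

Definition K_projective_resolution (M P : dgModule A) (p : {linear P -> M}) :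
    Prop :=
  K_projective P /\ quasi_iso p.

(* The derived Hom complex from M to N is Hom(P, N) for a K-projective
   resolution P -> M. It is not acyclic: a resolution exists, and the complex
   computed by any of them is not acyclic. *)
Definition derived_Hom_nonzero (M N : dgModule A) : Prop :=
  (exists (P : dgModule A) (p : {linear P -> M}), K_projective_resolution p) /\
  (forall (P : dgModule A) (p : {linear P -> M}),
     K_projective_resolution p -> ~ hom_acyclic P N).

End DerivedHom.

(* Main.v *)
Require Import Defs.
From HB Require Import structures.
From mathcomp Require Import all_boot all_order all_algebra.
From mathcomp Require Import zify boolp.
From mathcomp Require classical_sets.

(** A bounded below module M whose lowest cohomology is in degree m has a
    K-projective resolution that is, up to contractible summands, built from
    cells A[-i] with i >= m.  To get it, M is covered by a contractible module
    plus one cell for each cocycle of degree > m and for each element of a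
    k-basis of H^m(M); because H^0(A) = k and A is coconnective, the kernel of
    this cover has cohomology in degrees >= m + 1 only, and one iterates and
    totalizes.  Let n be the top degree of H^*(A).  A map that sends a basis
    cell of degree m to a nonzero class t of H^n(A) extends over all the other
    cells, the obstructions lying in H^j(A) with j > n.  The resulting cocycle of
    Hom(M, A) is nonzero on cohomology, hence is not a coboundary. *)

Set Implicit Arguments.
Unset Strict Implicit.
Unset Printing Implicit Defensive.

Import Order.TTheory GRing.Theory Num.Theory.
Local Open Scope ring_scope.

(** The cover is surjective and surjective on cocycles, so the cohomology of its kernel is the
    kernel of the map from the cohomology of the cover to that of X. In the lowest degree c this map
    has to be injective, which forbids one cell per cocycle there; a k-basis works because a cell of
    degree c contributes exactly H^0(A) = k in degree c and a higher cell contributes nothing. The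
    contractible summand gives surjectivity in every degree without changing cohomology or adding
    obstructions to maps. Lifting cocycles to cocycles matters a second time: the total complex is a
    direct sum over infinitely many columns of unbounded complexes, for which exactness of the rows
    alone need not give a resolution. Nonvanishing is required for every K-projective resolution,
    not only for the constructed one; a section up to homotopy transfers it. *)

(** * Signs, packaging of maps, finite sums *)

Lemma zsignD i j : zsign (i + j) = zsign i * zsign j.
Proof.
have E m : zsign m = (-1 : int) ^ m by case: m.
by rewrite !E exprzDr ?unitrN1.
Qed.

Lemma zsignS i : zsign (i + 1) = - zsign i.
Proof. by rewrite zsignD mulrN1. Qed.

Lemma zsignB1 i : zsign (i - 1) = - zsign i.
Proof. by rewrite zsignD mulrN1. Qed.

Lemma zsignN i : zsign (- i) = zsign i.
Proof. by rewrite /zsign abszN. Qed.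

Lemma zsignP i : zsign i = 1 \/ zsign i = - 1.
Proof. by rewrite /zsign -signr_odd; case: (odd _); [right | left]. Qed.

Lemma mulrz_zsignK (V : zmodType) (x : V) i : x *~ zsign i *~ zsign i = x.
Proof. by case: (zsignP i) => ->; rewrite ?mulr1z ?mulrN1z ?opprK. Qed.

Lemma subrACA (V : zmodType) (x y z t : V) : x - y - (z - t) = x - z - (y - t).
Proof. by rewrite !opprB addrACA [RHS]addrACA (addrC (- y)). Qed.

Definition mk_additive (U V : zmodType) (f : U -> V) (fB : zmod_morphism f) :
    {additive U -> V} :=
  HB.pack f (GRing.isZmodMorphism.Build U V f fB).

Definition mk_linear (R : pzRingType) (U V : lmodType R) (f : U -> V)
    (fL : linear f) : {linear U -> V} :=
  HB.pack f (GRing.isLinear.Build R U V *:%R f fL).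

Lemma big_uniq_sub (V : zmodType) (I : eqType) (s t : seq I) (F : I -> V) :
  uniq s -> uniq t -> {subset s <= t} ->
  (forall i, i \in t -> i \notin s -> F i = 0) ->
  \sum_(i <- t) F i = \sum_(i <- s) F i.
Proof.
move=> us ut st F0; rewrite (bigID (mem s)) /= [X in _ + X]big1_seq ?addr0.
  rewrite -big_filter; apply: perm_big; apply: uniq_perm => //.
    exact: filter_uniq.
  move=> i; rewrite mem_filter andbC.
  by apply/andP/idP => [[]//|si]; rewrite st.
by move=> i /andP[nsi ti]; apply: F0.
Qed.

(** * Homogeneous elements, cocycles and coboundaries *)

Section Graded.
Variables (V : zmodType) (S : dgStruct V).
Implicit Types (i j : int) (x y : V).

Lemma homog_pr i x : homog S i (dg_pr S i x).
Proof. by rewrite /homog dg_pr_pr eqxx. Qed.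

Lemma homog0 i : homog S i 0.
Proof. by rewrite /homog raddf0. Qed.

Lemma homogD i x y : homog S i x -> homog S i y -> homog S i (x + y).
Proof. by rewrite /homog raddfD /= => -> ->. Qed.

Lemma homogN i x : homog S i x -> homog S i (- x).
Proof. by rewrite /homog raddfN /= => ->. Qed.

Lemma homogB i x y : homog S i x -> homog S i y -> homog S i (x - y).
Proof. by move=> hx hy; apply: homogD => //; apply: homogN. Qed.

Lemma homogMz i x n : homog S i x -> homog S i (x *~ n).
Proof. by rewrite /homog raddfMz /= => ->. Qed.

Lemma homog_sum i (I : Type) (s : seq I) (F : I -> V) :
  (forall b, homog S i (F b)) -> homog S i (\sum_(b <- s) F b).
Proof. by move=> hF; apply: big_ind => //; [apply: homog0 | apply: homogD]. Qed.

Lemma homog_d i x : homog S i x -> homog S (i + 1) (dg_d S x).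
Proof. by rewrite /homog => {2}<-; rewrite dg_d_pr. Qed.

Lemma pr_homog i j x : homog S j x -> dg_pr S i x = if i == j then x else 0.
Proof. by rewrite /homog => <-; rewrite dg_pr_pr. Qed.

(** [dg_pr_fin] provides a single list of degrees; a form stable under enlargement lets the degrees
    of several elements be merged. *)
Lemma pr_fin_stable x : exists s : seq int, forall t, uniq t ->
  {subset s <= t} -> x = \sum_(i <- t) dg_pr S i x.
Proof.
have [s us xE] := dg_pr_fin S x; exists s => t ut st.
rewrite {1}xE; apply/esym/big_uniq_sub => // i _ si.
rewrite xE raddf_sum /= big1_seq // => j /andP[_ sj].
by rewrite dg_pr_pr; case: eqP => // ij; rewrite ij sj in si.
Qed.

Lemma cocycle0 i : cocycle S i 0.
Proof. by split; [apply: homog0 | rewrite raddf0]. Qed.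

Lemma cocycleD i x y : cocycle S i x -> cocycle S i y -> cocycle S i (x + y).
Proof.
move=> [hx dx] [hy dy]; split; first exact: homogD.
by rewrite raddfD /= dx dy addr0.
Qed.

Lemma cocycleN i x : cocycle S i x -> cocycle S i (- x).
Proof.
by move=> [hx dx]; split; [apply: homogN | rewrite raddfN /= dx oppr0].
Qed.

Lemma cocycleB i x y : cocycle S i x -> cocycle S i y -> cocycle S i (x - y).
Proof. by move=> cx cy; apply: cocycleD => //; apply: cocycleN. Qed.

Lemma coboundary0 i : coboundary S i 0.
Proof. by exists 0; [apply: homog0 | rewrite raddf0]. Qed.

Lemma coboundaryD i x y :
  coboundary S i x -> coboundary S i y -> coboundary S i (x + y).
Proof.
move=> [u hu <-] [v hv <-].
by exists (u + v); [apply: homogD | rewrite raddfD].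
Qed.

Lemma coboundaryN i x : coboundary S i x -> coboundary S i (- x).
Proof. by move=> [u hu <-]; exists (- u); [apply: homogN | rewrite raddfN]. Qed.

Lemma coboundaryB i x y :
  coboundary S i x -> coboundary S i y -> coboundary S i (x - y).
Proof. by move=> bx byy; apply: coboundaryD => //; apply: coboundaryN. Qed.

Lemma coboundary_cocycle i x : coboundary S i x -> cocycle S i x.
Proof.
move=> [u hu <-]; split; last exact: dg_d_d.
by rewrite -[X in homog _ X _](subrK 1); apply: homog_d.
Qed.

Lemma d_cocycle i x : homog S i x -> cocycle S (i + 1) (dg_d S x).
Proof. by move=> hx; split; [apply: homog_d | apply: dg_d_d]. Qed.

End Graded.

(* Exactness of Hom(M, N) in degree n; [hom_acyclic M N] is convertible to
   [forall n, hom_exact_at M N n]. *)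
Definition hom_exact_at (k : fieldType) (A : dgAlgebra k) (M N : dgModule A)
    (n : int) : Prop :=
  forall f : {linear M -> N}, hom_deg n f -> (forall x, hom_d n f x = 0) ->
    exists2 h : {linear M -> N}, hom_deg (n - 1) h &
      forall x, hom_d (n - 1) h x = f x.

(** * Hom complexes and chain maps *)

Section HomComplexes.
Variables (k : fieldType) (A : dgAlgebra k).
Implicit Types (M N P : dgModule A).

Lemma hom_pr M N n (f : {linear M -> N}) i x :
  hom_deg n f -> f (dg_pr (dgm_dg M) i x) = dg_pr (dgm_dg N) (i + n) (f x).
Proof.
move=> hf; have [s us xE] := dg_pr_fin (dgm_dg M) x.
rewrite [in RHS]xE [in LHS]xE !raddf_sum /=; apply: eq_bigr => j _.
have hj := hf _ _ (homog_pr (dgm_dg M) j x).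
rewrite (pr_homog _ (homog_pr _ j x)) (pr_homog _ hj).
rewrite (inj_eq (addIr n)); case: eqP => // _; exact: raddf0.
Qed.

Lemma hom_d0E M N n (f : {linear M -> N}) :
  (forall x, hom_d n f x = 0) ->
  forall x, dg_d (dgm_dg N) (f x) = f (dg_d (dgm_dg M) x) *~ zsign n.
Proof. by move=> f0 x; apply/eqP; rewrite -subr_eq0; apply/eqP/f0. Qed.

Lemma hom_d_additive M N n (h : {linear M -> N}) :
  zmod_morphism (hom_d n h : M -> N).
Proof.
move=> x y; rewrite /hom_d [dg_d _ (x - y)]raddfB ![h _]raddfB.
by rewrite [dg_d _ _]raddfB mulrzBl subrACA.
Qed.

Lemma chain_mapP M N (f : {linear M -> N}) : chain_map f ->
  (forall i x, homog (dgm_dg M) i x -> homog (dgm_dg N) i (f x)) /\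
  (forall x, dg_d (dgm_dg N) (f x) = f (dg_d (dgm_dg M) x)).
Proof.
move=> [hf f0]; split=> [i x /hf|x]; first by rewrite addr0.
exact: hom_d0E f0 x.
Qed.

Lemma chain_map_intro M N (f : {linear M -> N}) :
  (forall i x, homog (dgm_dg M) i x -> homog (dgm_dg N) i (f x)) ->
  (forall x, dg_d (dgm_dg N) (f x) = f (dg_d (dgm_dg M) x)) ->
  chain_map f.
Proof.
move=> hf fd; split=> [i x /hf|x]; first by rewrite addr0.
by rewrite /hom_d fd mulr1z subrr.
Qed.

Lemma chain_map_cocycle M N (f : {linear M -> N}) i z : chain_map f ->
  cocycle (dgm_dg M) i z -> cocycle (dgm_dg N) i (f z).
Proof.
move=> /chain_mapP[hf fd] [hz dz]; split; first exact: hf.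
by rewrite fd dz raddf0.
Qed.

Lemma chain_map_coboundary M N (f : {linear M -> N}) i z : chain_map f ->
  coboundary (dgm_dg M) i z -> coboundary (dgm_dg N) i (f z).
Proof.
move=> /chain_mapP[hf fd] [y hy <-].
by exists (f y); [apply: hf | rewrite fd].
Qed.

(** A null-homotopic map vanishes on cohomology: on a cocycle the term in [h] after the differential
    drops out. *)
Lemma hom_coboundary M N n (f h : {linear M -> N}) i z :
  hom_deg (n - 1) h -> (forall x, hom_d (n - 1) h x = f x) ->
  cocycle (dgm_dg M) i z -> coboundary (dgm_dg N) (i + n) (f z).
Proof.
move=> hh hf [hz dz]; exists (h z); first by rewrite -addrA; apply: hh.
by rewrite -hf /hom_d dz raddf0 mul0rz subr0.
Qed.

Lemma hom_preserves_coboundary M N n (f : {linear M -> N}) i z :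
  hom_deg n f -> (forall x, hom_d n f x = 0) ->
  coboundary (dgm_dg M) i z -> coboundary (dgm_dg N) (i + n) (f z).
Proof.
move=> hf f0 [y hy <-]; exists (f y *~ zsign n).
  by apply: homogMz; rewrite addrAC; apply: hf.
by rewrite raddfMz /= (hom_d0E f0) mulrz_zsignK.
Qed.

(* For a cocycle f, the map (-1)^n f s is a primitive. *)
Lemma hom_exact_at_contractible M N n (s : {linear M -> M}) :
  hom_deg (-1) s ->
  (forall x, dg_d (dgm_dg M) (s x) + s (dg_d (dgm_dg M) x) = x) ->
  hom_exact_at M N n.
Proof.
move=> hs sE f hf f0.
pose g x := f (s x) *~ zsign n.
have gL : linear g.
  by move=> a x y; rewrite /g !linearP mulrzDl scalerMzr.
exists (mk_linear gL) => [i x hx|x]; rewrite /=.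
  by apply: homogMz; rewrite addrCA addrC; apply/hf/hs.
rewrite /hom_d /= /g raddfMz /= (hom_d0E f0) mulrz_zsignK zsignB1 mulrNz opprK.
by rewrite mulrz_zsignK -raddfD sE.
Qed.

End HomComplexes.

(** * Shifts and direct sums *)

(* The degree of every element is raised by m; the right action needs no sign,
   only the differential does. *)
Section Shift.
Variables (k : fieldType) (A : dgAlgebra k) (M : dgModule A) (m : int).

Definition shift_pr i : {additive M -> M} := dg_pr (dgm_dg M) (i - m).

Fact shift_d_additive :
  zmod_morphism (fun x : M => dg_d (dgm_dg M) x *~ zsign m).
Proof. by move=> x y; rewrite raddfB mulrzBl. Qed.

Fact shift_pr_pr i j x :
  shift_pr i (shift_pr j x) = if i == j then shift_pr j x else 0.
Proof. by rewrite /shift_pr dg_pr_pr (inj_eq (addIr _)). Qed.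

Fact shift_pr_fin x :
  exists2 s : seq int, uniq s & x = \sum_(i <- s) shift_pr i x.
Proof.
have [s us xE] := dg_pr_fin (dgm_dg M) x.
exists [seq i + m | i <- s]; first by rewrite map_inj_uniq //; apply: addIr.
by rewrite big_map {1}xE; apply: eq_bigr => i _; rewrite /shift_pr addrK.
Qed.

Fact shift_d_pr i x :
  mk_additive shift_d_additive (shift_pr i x) =
  shift_pr (i + 1) (mk_additive shift_d_additive x).
Proof. by rewrite /= /shift_pr raddfMz /= dg_d_pr addrAC. Qed.

Fact shift_d_d x :
  mk_additive shift_d_additive (mk_additive shift_d_additive x) = 0.
Proof. by rewrite /= raddfMz /= dg_d_d !mul0rz. Qed.

Definition shift_dg : dgStruct M :=
  DgStruct shift_pr_pr shift_pr_fin shift_d_pr shift_d_d.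

Fact homog_shift i x : homog shift_dg i x = homog (dgm_dg M) (i - m) x.
Proof. by []. Qed.

Fact shift_act i j (x : M) (a : A) :
  homog shift_dg i x -> homog (dga_dg A) j a ->
  homog shift_dg (i + j) ((a : A^c) *: x).
Proof. by rewrite !homog_shift addrAC; apply: dgm_act. Qed.

Fact shift_leibniz i (x : M) (a : A) : homog shift_dg i x ->
  dg_d shift_dg ((a : A^c) *: x) =
    (a : A^c) *: dg_d shift_dg x + ((dg_d (dga_dg A) a : A^c) *: x) *~ zsign i.
Proof.
rewrite homog_shift /= => hx; rewrite (dgm_leibniz _ hx) mulrzDl scalerMzr.
by rewrite -mulrzA -zsignD subrK.
Qed.

Definition shift : dgModule A := DgModule shift_act shift_leibniz.

Lemma shift_d x : dg_d (dgm_dg shift) x = dg_d (dgm_dg M) x *~ zsign m.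
Proof. by []. Qed.

Lemma shift_homog i x :
  homog (dgm_dg shift) i x = homog (dgm_dg M) (i - m) x.
Proof. by []. Qed.

(** The same linear map, without any sign, has degree n out of the shift and n + m out of M: the
    sign of the shifted differential is absorbed by [zsign (n + m)]. *)
Lemma hom_exact_at_shift (N : dgModule A) n :
  hom_exact_at M N (n + m) -> hom_exact_at shift N n.
Proof.
move=> MN f hf f0; have [||h hh hE] := MN f.
- move=> i x hx; rewrite addrCA addrC; apply: hf.
  by rewrite shift_homog addrK.
- move=> x; rewrite -(f0 x) /hom_d /= [f (_ *~ _)]raddfMz.
  by rewrite zsignD mulrzA mulrzAC.
exists h => [i x|x].
  by rewrite shift_homog => /hh; congr homog; lia.
rewrite -hE /hom_d /= [h (_ *~ _)]raddfMz -mulrzA.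
by congr (_ - _ *~ _); rewrite -zsignD; congr zsign; lia.
Qed.

End Shift.

Section DirectSum.
Variables (R : pzRingType) (I : choiceType) (V : I -> lmodType R).

(** The sums run over arbitrary sets of cells. The support is only asserted to exist, so that
    equality is pointwise. *)
Record dsum := Dsum {
  dsum_val :> forall b, V b;
  dsum_fin : exists s : seq I, forall b, b \notin s -> dsum_val b = 0
}.

Lemma dsumP (x y : dsum) : (forall b, x b = y b) -> x = y.
Proof.
case: x y => [x xf] [y yf] /= xy.
have {xy} E : x = y by apply: functional_extensionality_dep.
by rewrite -{y}E in yf *; congr Dsum; apply: Prop_irrelevance.
Qed.

HB.instance Definition _ := gen_eqMixin dsum.
HB.instance Definition _ := gen_choiceMixin dsum.

Definition dsum0 : dsum :=
  @Dsum (fun=> 0) (ex_intro _ [::] (fun _ _ => erefl)).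

Fact dsum_opp_fin (x : dsum) :
  exists s : seq I, forall b, b \notin s -> - x b = 0.
Proof. by have [s xs] := dsum_fin x; exists s => b /xs ->; rewrite oppr0. Qed.

Definition dsum_opp x := Dsum (dsum_opp_fin x).

Fact dsum_add_fin (x y : dsum) :
  exists s : seq I, forall b, b \notin s -> x b + y b = 0.
Proof.
have [s xs] := dsum_fin x; have [t yt] := dsum_fin y; exists (s ++ t) => b.
by rewrite mem_cat negb_or => /andP[/xs -> /yt ->]; rewrite addr0.
Qed.

Definition dsum_add x y := Dsum (dsum_add_fin x y).

Fact dsum_scale_fin a (x : dsum) :
  exists s : seq I, forall b, b \notin s -> a *: x b = 0.
Proof. by have [s xs] := dsum_fin x; exists s => b /xs ->; rewrite scaler0. Qed.

Definition dsum_scale a x := Dsum (dsum_scale_fin a x).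

Fact dsum_addA : associative dsum_add.
Proof. by move=> x y z; apply: dsumP => b /=; rewrite addrA. Qed.

Fact dsum_addC : commutative dsum_add.
Proof. by move=> x y; apply: dsumP => b /=; rewrite addrC. Qed.

Fact dsum_add0 : left_id dsum0 dsum_add.
Proof. by move=> x; apply: dsumP => b /=; rewrite add0r. Qed.

Fact dsum_addN : left_inverse dsum0 dsum_opp dsum_add.
Proof. by move=> x; apply: dsumP => b /=; rewrite addNr. Qed.

HB.instance Definition _ :=
  GRing.isZmodule.Build dsum dsum_addA dsum_addC dsum_add0 dsum_addN.

Fact dsum_scaleA a b x : dsum_scale a (dsum_scale b x) = dsum_scale (a * b) x.
Proof. by apply: dsumP => c /=; rewrite scalerA. Qed.

Fact dsum_scale1 : left_id 1 dsum_scale.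
Proof. by move=> x; apply: dsumP => c /=; rewrite scale1r. Qed.

Fact dsum_scaleDr : right_distributive dsum_scale +%R.
Proof. by move=> a x y; apply: dsumP => c /=; rewrite scalerDr. Qed.

Fact dsum_scaleDl x : {morph dsum_scale^~ x : a b / a + b}.
Proof. by move=> a b; apply: dsumP => c /=; rewrite scalerDl. Qed.

HB.instance Definition _ :=
  GRing.Zmodule_isLmodule.Build R dsum
    dsum_scaleA dsum_scale1 dsum_scaleDr dsum_scaleDl.

Lemma dsumD (x y : dsum) b : (x + y) b = x b + y b. Proof. by []. Qed.
Lemma dsumB (x y : dsum) b : (x - y) b = x b - y b. Proof. by []. Qed.
Lemma dsumZ a (x : dsum) b : (a *: x) b = a *: x b. Proof. by []. Qed.
Definition dsum_proj b : {linear dsum -> V b} :=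
  @mk_linear R dsum (V b) (fun x => x b) (fun _ _ _ => erefl).

Lemma dsum_sumE (J : Type) (s : seq J) (F : J -> dsum) b :
  (\sum_(j <- s) F j) b = \sum_(j <- s) F j b.
Proof. exact: (raddf_sum (dsum_proj b)). Qed.

Lemma dsumMz (x : dsum) n b : (x *~ n) b = x b *~ n.
Proof. exact: (raddfMz (dsum_proj b)). Qed.

Fact dsum_inj_fin b (v : V b) : exists s : seq I, forall c, c \notin s ->
  dfwith (fun=> 0) v c = 0 :> V c.
Proof.
exists [:: b] => c; rewrite inE eq_sym => bc.
by rewrite dfwith_out.
Qed.

Definition dsum_inj_fun b v : dsum := Dsum (@dsum_inj_fin b v).

Fact dsum_inj_linear b : linear (@dsum_inj_fun b).
Proof.
move=> a u v; apply: dsumP => c; rewrite dsumD dsumZ /=.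
have [<-|bc] := eqVneq b c; first by rewrite !dfwith_in.
by rewrite !dfwith_out // scaler0 addr0.
Qed.

Definition dsum_inj b : {linear V b -> dsum} := mk_linear (@dsum_inj_linear b).

Lemma dsum_inj_same b (v : V b) : dsum_inj b v b = v.
Proof. by rewrite /= dfwith_in. Qed.

Lemma dsum_inj_neq b c (v : V b) : b != c -> dsum_inj b v c = 0.
Proof. by move=> bc; rewrite /= dfwith_out. Qed.

Lemma dsum_supp (x : dsum) :
  exists2 s : seq I, uniq s & forall b, b \notin s -> x b = 0.
Proof.
have [s xs] := dsum_fin x; exists (undup s); first exact: undup_uniq.
by move=> b; rewrite mem_undup; apply: xs.
Qed.

Lemma dsum_decomp (x : dsum) s : uniq s -> (forall b, b \notin s -> x b = 0) ->
  x = \sum_(b <- s) dsum_inj b (x b).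
Proof.
move=> us xs; apply: dsumP => c; rewrite dsum_sumE.
case: (boolP (c \in s)) => cs; last first.
  rewrite xs // big1_seq // => b /andP[_ bs]; apply: dsum_inj_neq.
  by apply: contraNneq cs => <-.
rewrite (bigD1_seq c) //= dfwith_in big1 ?addr0 // => b bc.
exact: dsum_inj_neq.
Qed.

Section Copair.
Variables (W : lmodType R) (phi : forall b, {linear V b -> W}).

Definition dsum_supp_seq (x : dsum) : seq I := s2val (cid2 (dsum_supp x)).

Definition dsum_copair_fun (x : dsum) : W :=
  \sum_(b <- dsum_supp_seq x) phi b (x b).

(** Two supports are compared through their union, where the extra terms vanish. This independence
    of the chosen support is what yields linearity. *)
Lemma dsum_copair_funE (x : dsum) s :
  uniq s -> (forall b, b \notin s -> x b = 0) ->
  dsum_copair_fun x = \sum_(b <- s) phi b (x b).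
Proof.
move=> us xs; rewrite /dsum_copair_fun /dsum_supp_seq.
case: cid2 => t /= ut xt; pose r := undup (s ++ t).
have ur : uniq r by apply: undup_uniq.
transitivity (\sum_(b <- r) phi b (x b)); last first.
  apply: big_uniq_sub => // [b sb|b _ /xs ->]; last exact: raddf0.
  by rewrite mem_undup mem_cat sb.
apply/esym/big_uniq_sub => // [b sb|b _ /xt ->]; last exact: raddf0.
by rewrite mem_undup mem_cat sb orbT.
Qed.

Fact dsum_copair_linear : linear dsum_copair_fun.
Proof.
move=> a x y; have [s us xs] := dsum_supp x; have [t ut yt] := dsum_supp y.
pose r := undup (s ++ t); have ur : uniq r by apply: undup_uniq.
have xr b : b \notin r -> x b = 0.
  by rewrite mem_undup mem_cat negb_or => /andP[/xs].
have yr b : b \notin r -> y b = 0.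
  by rewrite mem_undup mem_cat negb_or => /andP[_ /yt].
rewrite !(@dsum_copair_funE _ r) //; last first.
  by move=> b br; rewrite dsumD dsumZ xr // yr // scaler0 addr0.
rewrite scaler_sumr -big_split /=; apply: eq_bigr => b _.
by rewrite linearP.
Qed.

Definition dsum_copair : {linear dsum -> W} := mk_linear dsum_copair_linear.

Lemma dsum_copair_inj b v : dsum_copair (dsum_inj b v) = phi b v.
Proof.
rewrite /= (@dsum_copair_funE _ [:: b]) //.
  by rewrite big_seq1 dsum_inj_same.
by move=> c; rewrite inE eq_sym => bc; rewrite dsum_inj_neq.
Qed.

End Copair.

(** Stated for additive maps because it is applied to [hom_d n h], which is packaged only as an
    additive map. *)
Lemma dsum_ext (W : zmodType) (f g : {additive dsum -> W}) :
  (forall b v, f (dsum_inj b v) = g (dsum_inj b v)) -> forall x, f x = g x.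
Proof.
move=> fg x; have [s us xs] := dsum_supp x.
rewrite (dsum_decomp us xs) !raddf_sum; apply: eq_bigr => b _; exact: fg.
Qed.

End DirectSum.

(** * Direct sums, twists and homotopy fibers of dg modules *)

Section DgDirectSum.
Variables (k : fieldType) (A : dgAlgebra k) (I : choiceType).
Variable V : I -> dgModule A.

Notation T := (dsum V).

Section Map.
Variable f : forall b, {additive V b -> V b}.

Fact dsum_map_fin (x : T) :
  exists s : seq I, forall b, b \notin s -> f b (x b) = 0.
Proof. by have [s xs] := dsum_fin x; exists s => b /xs ->; rewrite raddf0. Qed.

Fact dsum_map_additive :
  zmod_morphism (fun x : T => Dsum (dsum_map_fin x) : T).
Proof. by move=> x y; apply: dsumP => b; rewrite dsumB /= raddfB. Qed.

Definition dsum_map : {additive T -> T} := mk_additive dsum_map_additive.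

Lemma dsum_mapE x b : dsum_map x b = f b (x b).
Proof. by []. Qed.

End Map.

Definition dsum_pr i := dsum_map (fun b => dg_pr (dgm_dg (V b)) i).
Definition dsum_d := dsum_map (fun b => dg_d (dgm_dg (V b))).

Fact dsum_pr_pr i j x :
  dsum_pr i (dsum_pr j x) = if i == j then dsum_pr j x else 0.
Proof.
by apply: dsumP => b; rewrite !dsum_mapE dg_pr_pr; case: ifP.
Qed.

Fact dsum_pr_fin x :
  exists2 s : seq int, uniq s & x = \sum_(i <- s) dsum_pr i x.
Proof.
have [t xt] := dsum_fin x.
have [u uP] : exists u : seq int, forall b, b \in t -> forall r, uniq r ->
    {subset u <= r} -> x b = \sum_(i <- r) dg_pr (dgm_dg (V b)) i (x b).
  elim: t {xt} => [|c t [u IH]]; first by exists [::].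
  have [v vP] := pr_fin_stable (dgm_dg (V c)) (x c).
  exists (v ++ u) => b; rewrite inE => /predU1P[->|bt] r ur sr.
    by apply: vP => // i iv; rewrite sr // mem_cat iv.
  by apply: IH => // i iv; rewrite sr // mem_cat iv orbT.
exists (undup u); first exact: undup_uniq.
apply: dsumP => b; rewrite dsum_sumE; case: (boolP (b \in t)) => bt.
  by apply: uP => //; [apply: undup_uniq | move=> i; rewrite mem_undup].
by rewrite xt // big1 // => i _; rewrite dsum_mapE xt // raddf0.
Qed.

Fact dsum_d_pr i x : dsum_d (dsum_pr i x) = dsum_pr (i + 1) (dsum_d x).
Proof. by apply: dsumP => b; rewrite !dsum_mapE dg_d_pr. Qed.

Fact dsum_d_d x : dsum_d (dsum_d x) = 0.
Proof. by apply: dsumP => b; rewrite !dsum_mapE dg_d_d. Qed.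

Definition dsum_dgs : dgStruct T :=
  DgStruct dsum_pr_pr dsum_pr_fin dsum_d_pr dsum_d_d.

Lemma homog_dsumP i (x : T) :
  homog dsum_dgs i x <-> forall b, homog (dgm_dg (V b)) i (x b).
Proof.
split=> [hx b|hx]; first by rewrite /homog -[in RHS]hx.
by apply: dsumP => b; rewrite dsum_mapE hx.
Qed.

Fact dsum_act i j (x : T) (a : A) :
  homog dsum_dgs i x -> homog (dga_dg A) j a ->
  homog dsum_dgs (i + j) ((a : A^c) *: x).
Proof.
by move=> /homog_dsumP hx ha; apply/homog_dsumP => b; apply: dgm_act.
Qed.

Fact dsum_leibniz i (x : T) (a : A) : homog dsum_dgs i x ->
  dg_d dsum_dgs ((a : A^c) *: x) =
    (a : A^c) *: dg_d dsum_dgs x + ((dg_d (dga_dg A) a : A^c) *: x) *~ zsign i.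
Proof.
move=> /homog_dsumP hx; apply: dsumP => b.
by rewrite dsumD dsumMz; apply: dgm_leibniz.
Qed.

Definition dg_dsum : dgModule A := DgModule dsum_act dsum_leibniz.

Lemma dg_dsum_homogP i (x : dg_dsum) :
  homog (dgm_dg dg_dsum) i x <-> forall b, homog (dgm_dg (V b)) i (x b).
Proof. exact: homog_dsumP. Qed.

Lemma dg_dsum_dE (x : dg_dsum) b :
  dg_d (dgm_dg dg_dsum) x b = dg_d (dgm_dg (V b)) (x b).
Proof. by []. Qed.

Lemma dg_dsum_inj_homog i b v :
  homog (dgm_dg (V b)) i v -> homog (dgm_dg dg_dsum) i (dsum_inj V b v).
Proof.
move=> hv; apply/dg_dsum_homogP => c.
have [<-|bc] := eqVneq b c; first by rewrite dsum_inj_same.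
by rewrite dsum_inj_neq //; apply: homog0.
Qed.

Lemma dg_dsum_d_inj b v :
  dg_d (dgm_dg dg_dsum) (dsum_inj V b v) =
  dsum_inj V b (dg_d (dgm_dg (V b)) v).
Proof.
apply: dsumP => c; rewrite dg_dsum_dE.
have [<-|bc] := eqVneq b c; first by rewrite !dsum_inj_same.
by rewrite !dsum_inj_neq // raddf0.
Qed.

Lemma dg_dsum_cocycleP i (z : dg_dsum) :
  cocycle (dgm_dg dg_dsum) i z <-> forall b, cocycle (dgm_dg (V b)) i (z b).
Proof.
split=> [[/dg_dsum_homogP hz dz] b|cz].
  by split; [apply: hz | rewrite -dg_dsum_dE dz].
split; first by apply/dg_dsum_homogP => b; case: (cz b).
by apply: dsumP => b; rewrite dg_dsum_dE; case: (cz b).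
Qed.

(** A choice of primitives for all components need not have finite support, so z is first split into
    its finitely many nonzero components. *)
Lemma dg_dsum_coboundary i (z : dg_dsum) :
  (forall b, coboundary (dgm_dg (V b)) i (z b)) ->
  coboundary (dgm_dg dg_dsum) i z.
Proof.
move=> bz; have [s us zs] := dsum_supp z.
rewrite (dsum_decomp us zs); apply: big_ind; [exact: coboundary0 | |].
  exact: coboundaryD.
move=> b _; have [y hy yE] := bz b.
by exists (dsum_inj V b y); [apply: dg_dsum_inj_homog |
  rewrite dg_dsum_d_inj yE].
Qed.

Definition dg_copair (N : dgModule A) (phi : forall b, {linear V b -> N}) :
    {linear dg_dsum -> N} := dsum_copair phi.

Lemma dg_copair_inj (N : dgModule A) (phi : forall b, {linear V b -> N}) b v :
  dg_copair phi (dsum_inj V b v) = phi b v.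
Proof. exact: dsum_copair_inj. Qed.

Lemma dg_copair_deg (N : dgModule A) n (phi : forall b, {linear V b -> N}) :
  (forall b, hom_deg n (phi b)) -> hom_deg n (dg_copair phi).
Proof.
move=> hphi i x /dg_dsum_homogP hx; have [s us xs] := dsum_supp x.
rewrite /= (dsum_copair_funE _ us xs); apply: homog_sum => b; exact: hphi.
Qed.

(** Hom out of a direct sum is a product: primitives are chosen on each summand and glued by
    copairing. *)
Lemma hom_exact_at_dsum (N : dgModule A) n :
  (forall b, hom_exact_at (V b) N n) -> hom_exact_at dg_dsum N n.
Proof.
move=> VN f hf f0.
have H b : exists h : {linear V b -> N},
    hom_deg (n - 1) h /\ forall v, hom_d (n - 1) h v = f (dsum_inj V b v).
  have [|v|h hh hE] := VN b (f \o dsum_inj V b : {linear V b -> N}).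
  - by move=> i v hv; apply: hf; apply: dg_dsum_inj_homog.
  - by have := f0 (dsum_inj V b v); rewrite /hom_d dg_dsum_d_inj.
  - by exists h.
pose phi b := sval (cid (H b)).
have phiP b : hom_deg (n - 1) (phi b) /\
    forall v, hom_d (n - 1) (phi b) v = f (dsum_inj V b v).
  by rewrite /phi; case: cid.
exists (dg_copair phi).
  by apply: dg_copair_deg => b; case: (phiP b).
set h := dg_copair phi.
apply: (dsum_ext (f := mk_additive (hom_d_additive (n - 1) h))) => b v.
change (hom_d (n - 1) h (dsum_inj V b v) = f (dsum_inj V b v)).
by rewrite -(phiP b).2 /hom_d dg_dsum_d_inj !dg_copair_inj.
Qed.

End DgDirectSum.

(* M with the differential d + tau; [tau_mc] is the Maurer-Cartan equation. *)
Section Twist.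
Variables (k : fieldType) (A : dgAlgebra k) (M : dgModule A).
Variable tau : {linear M -> M}.
Hypothesis tau_deg : hom_deg 1 tau.
Hypothesis tau_mc : forall x,
  dg_d (dgm_dg M) (tau x) + tau (dg_d (dgm_dg M) x) + tau (tau x) = 0.

Fact twist_d_additive :
  zmod_morphism (fun x : M => dg_d (dgm_dg M) x + tau x).
Proof. by move=> x y; rewrite !raddfB addrACA -opprD. Qed.

Fact twist_d_pr i x :
  mk_additive twist_d_additive (dg_pr (dgm_dg M) i x) =
  dg_pr (dgm_dg M) (i + 1) (mk_additive twist_d_additive x).
Proof. by rewrite /= raddfD /= dg_d_pr (hom_pr _ _ tau_deg). Qed.

Fact twist_d_d x :
  mk_additive twist_d_additive (mk_additive twist_d_additive x) = 0.
Proof.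
by rewrite /= !raddfD /= dg_d_d add0r addrA tau_mc.
Qed.

Definition twist_dg : dgStruct M :=
  DgStruct (@dg_pr_pr _ (dgm_dg M)) (@dg_pr_fin _ (dgm_dg M))
    twist_d_pr twist_d_d.

Fact twist_leibniz i (x : M) (a : A) : homog twist_dg i x ->
  dg_d twist_dg ((a : A^c) *: x) =
    (a : A^c) *: dg_d twist_dg x + ((dg_d (dga_dg A) a : A^c) *: x) *~ zsign i.
Proof.
by move=> hx; rewrite /= (dgm_leibniz _ (hx : homog (dgm_dg M) i x)) linearZ
  scalerDr addrAC.
Qed.

Definition twist : dgModule A :=
  @DgModule _ A M twist_dg (@dgm_act _ A M) twist_leibniz.

Lemma twist_dE (x : twist) :
  dg_d (dgm_dg twist) x = dg_d (dgm_dg M) x + tau x.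
Proof. by []. Qed.

End Twist.

Lemma pair_ext (T U : Type) (x y : T * U) : x.1 = y.1 -> x.2 = y.2 -> x = y.
Proof. by case: x y => [? ?] [? ?] /= -> ->. Qed.

(* The homotopy fiber Cone(f)[-1]: pairs (x, y) of degrees (i, i - 1). *)
Section Fiber.
Variables (k : fieldType) (A : dgAlgebra k) (M N : dgModule A).
Variable f : {linear M -> N}.
Hypothesis f_chain : chain_map f.

Notation T := (M * N)%type.

Fact fiber_pr_additive i : zmod_morphism (fun x : T =>
  (dg_pr (dgm_dg M) i x.1, dg_pr (dgm_dg N) (i - 1) x.2) : T).
Proof. by move=> x y; apply: pair_ext; apply: raddfB. Qed.

Definition fiber_pr i := mk_additive (fiber_pr_additive i).

Fact fiber_d_additive : zmod_morphism (fun x : T =>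
  (dg_d (dgm_dg M) x.1, f x.1 - dg_d (dgm_dg N) x.2) : T).
Proof.
move=> x y; apply: pair_ext; first exact: raddfB.
by rewrite /= (raddfB f) [dg_d _ (_ - _)]raddfB subrACA.
Qed.

Definition fiber_d := mk_additive fiber_d_additive.

Fact fiber_pr_pr i j x :
  fiber_pr i (fiber_pr j x) = if i == j then fiber_pr j x else 0.
Proof.
by rewrite /fiber_pr /= !dg_pr_pr (inj_eq (addIr (- 1))); case: eqP.
Qed.

Fact fiber_pr_fin x :
  exists2 s : seq int, uniq s & x = \sum_(i <- s) fiber_pr i x.
Proof.
have [s sP] := pr_fin_stable (dgm_dg M) x.1.
have [t tP] := pr_fin_stable (dgm_dg N) x.2.
pose r := undup (s ++ map (+%R^~ 1) t); have ur : uniq r by apply: undup_uniq.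
exists r => //; apply: pair_ext.
  rewrite (raddf_sum fst) {1}(sP r) //= => i si.
  by rewrite mem_undup mem_cat si.
rewrite (raddf_sum snd) {1}(tP (map (fun i => i - 1) r)) ?big_map //.
  by rewrite map_inj_uniq //; apply: addIr.
move=> i ti; apply/mapP; exists (i + 1); last by rewrite addrK.
by rewrite mem_undup mem_cat; apply/orP; right; apply/mapP; exists i.
Qed.

Fact fiber_d_pr i x : fiber_d (fiber_pr i x) = fiber_pr (i + 1) (fiber_d x).
Proof.
rewrite /fiber_d /fiber_pr /= dg_d_pr (hom_pr _ _ f_chain.1) addr0 raddfB /=.
by rewrite dg_d_pr !addrK.
Qed.

Fact fiber_d_d x : fiber_d (fiber_d x) = 0.
Proof.
have [_ fd] := chain_mapP f_chain.
by rewrite /fiber_d /= dg_d_d raddfB /= fd dg_d_d subr0 subrr.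
Qed.

Definition fiber_dg : dgStruct T :=
  DgStruct fiber_pr_pr fiber_pr_fin fiber_d_pr fiber_d_d.

Lemma homog_fiberP i (x : T) : homog fiber_dg i x <->
  homog (dgm_dg M) i x.1 /\ homog (dgm_dg N) (i - 1) x.2.
Proof. by case: x => x y; rewrite /homog /=; split => [[]|[-> ->]]. Qed.

Fact fiber_act i j (x : T) (a : A) :
  homog fiber_dg i x -> homog (dga_dg A) j a ->
  homog fiber_dg (i + j) ((a : A^c) *: x).
Proof.
move=> /homog_fiberP[hx hy] ha; apply/homog_fiberP; split; first exact: dgm_act.
by rewrite addrAC; apply: dgm_act.
Qed.

Fact fiber_leibniz i (x : T) (a : A) : homog fiber_dg i x ->
  dg_d fiber_dg ((a : A^c) *: x) =
    (a : A^c) *: dg_d fiber_dg x + ((dg_d (dga_dg A) a : A^c) *: x) *~ zsign i.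
Proof.
move=> /homog_fiberP[hx hy]; apply: pair_ext.
  by rewrite /= (dgm_leibniz _ hx) raddfMz.
rewrite raddfD raddfMz /= (dgm_leibniz _ hy) linearZ scalerBr zsignB1 mulrNz.
by rewrite opprD opprK addrA.
Qed.

Definition fiber : dgModule A := DgModule fiber_act fiber_leibniz.

Lemma fiber_homogP i (x : fiber) : homog (dgm_dg fiber) i x <->
  homog (dgm_dg M) i x.1 /\ homog (dgm_dg N) (i - 1) x.2.
Proof. exact: homog_fiberP. Qed.

(** For a cocycle (x, y), injectivity on cohomology gives a primitive x' of x; surjectivity then
    corrects x' by a cocycle z so that f (x' - z) - y is exact. *)
Lemma fiber_acyclic : quasi_iso f -> acyclic fiber.
Proof.
move=> [_ finj fsurj] i [x y] [/fiber_homogP[/= hx hy] dxy].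
have [fh fd] := chain_mapP f_chain.
have dx : dg_d (dgm_dg M) x = 0 := congr1 fst dxy.
have /subr0_eq fxy : f x - dg_d (dgm_dg N) y = 0 := congr1 snd dxy.
have [x' hx' x'E] : coboundary (dgm_dg M) i x.
  by apply: finj => //; exists y.
have [|z [hz dz] [y' hy' y'E]] := fsurj (i - 1) (f x' - y).
  split; first by apply: homogB => //; apply: fh.
  by rewrite raddfB /= fd x'E fxy subrr.
exists ((x' - z, y') : fiber).
  by apply/fiber_homogP; split=> //=; apply: homogB.
apply: pair_ext; first by rewrite /= raddfB /= dz x'E subr0.
by rewrite /= (raddfB f) y'E [f x' - y - _]addrAC subKr.
Qed.

End Fiber.

(** * Kernels and bases of cohomology *)

Section KernelModule.
Variables (R : pzRingType) (M N : lmodType R) (p : {linear M -> N}).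

Definition ker_pred : {pred M} := [pred x | p x == 0].

Fact ker_pred_closed : submod_closed ker_pred.
Proof.
split=> [|a x y]; rewrite !inE ?raddf0 // => /eqP px /eqP py.
by rewrite linearP px py scaler0 addr0.
Qed.

HB.instance Definition _ :=
  GRing.isSubmodClosed.Build R M ker_pred ker_pred_closed.

Record ker := Ker { ker_val : M; ker_valP : ker_val \in ker_pred }.

HB.instance Definition _ := [isSub for ker_val].
HB.instance Definition _ := [Choice of ker by <:].
HB.instance Definition _ := [SubChoice_isSubLmodule of ker by <:].

Fact ker_incl_linear : linear (fun x : ker => ker_val x).
Proof. by []. Qed.

Definition ker_incl : {linear ker -> M} := mk_linear ker_incl_linear.

Lemma ker_incl_inj : injective ker_incl.
Proof. exact: val_inj. Qed.

Lemma ker_inclP x : p (ker_incl x) = 0.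
Proof. by apply/eqP; apply: ker_valP. Qed.

Lemma ker_lift x : p x = 0 -> exists y, ker_incl y = x.
Proof. by move=> /eqP px; exists (Ker (px : x \in ker_pred)). Qed.

End KernelModule.

Section Kernel.
Variables (k : fieldType) (A : dgAlgebra k) (M N : dgModule A).
Variable p : {linear M -> N}.
Hypothesis p_chain : chain_map p.

Section Restrict.
Variable f : {additive M -> M}.
Hypothesis f_ker : forall x, p x = 0 -> p (f x) = 0.

Fact ker_restr_subproof (x : ker p) : f (ker_incl p x) \in ker_pred p.
Proof. by apply/eqP/f_ker/ker_inclP. Qed.

Fact ker_restr_additive :
  zmod_morphism (fun x : ker p => Ker (ker_restr_subproof x)).
Proof.
move=> x y; apply: (@ker_incl_inj _ _ _ p).
rewrite [RHS]raddfB /=; exact: (raddfB f (ker_incl p x) (ker_incl p y)).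
Qed.

Definition ker_restr : {additive ker p -> ker p} :=
  mk_additive ker_restr_additive.

Lemma ker_restrE x : ker_incl p (ker_restr x) = f (ker_incl p x).
Proof. by []. Qed.

End Restrict.

Fact ker_pr_subproof i x : p x = 0 -> p (dg_pr (dgm_dg M) i x) = 0.
Proof. by move=> px; rewrite (hom_pr _ _ p_chain.1) px raddf0. Qed.

Definition ker_pr i := ker_restr (ker_pr_subproof i).

Fact ker_d_subproof x : p x = 0 -> p (dg_d (dgm_dg M) x) = 0.
Proof. by move=> px; rewrite -(chain_mapP p_chain).2 px raddf0. Qed.

Definition ker_d := ker_restr ker_d_subproof.

Fact ker_pr_pr i j x : ker_pr i (ker_pr j x) = if i == j then ker_pr j x else 0.
Proof.
by apply: (@ker_incl_inj _ _ _ p); rewrite !ker_restrE dg_pr_pr; case: ifP.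
Qed.

Fact ker_pr_fin x : exists2 s : seq int, uniq s & x = \sum_(i <- s) ker_pr i x.
Proof.
have [s us xE] := dg_pr_fin (dgm_dg M) (ker_incl p x); exists s => //.
by apply: (@ker_incl_inj _ _ _ p); rewrite raddf_sum.
Qed.

Fact ker_d_pr i x : ker_d (ker_pr i x) = ker_pr (i + 1) (ker_d x).
Proof. by apply: (@ker_incl_inj _ _ _ p); rewrite !ker_restrE dg_d_pr. Qed.

Fact ker_d_d x : ker_d (ker_d x) = 0.
Proof. by apply: (@ker_incl_inj _ _ _ p); rewrite !ker_restrE dg_d_d. Qed.

Definition ker_dgs : dgStruct (ker p) :=
  DgStruct ker_pr_pr ker_pr_fin ker_d_pr ker_d_d.

Lemma homog_kerP i x :
  homog ker_dgs i x <-> homog (dgm_dg M) i (ker_incl p x).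
Proof.
split=> [hx|hx]; first by rewrite /homog -[in RHS]hx.
by apply: (@ker_incl_inj _ _ _ p); rewrite ker_restrE hx.
Qed.

Fact ker_act i j (x : ker p) (a : A) :
  homog ker_dgs i x -> homog (dga_dg A) j a ->
  homog ker_dgs (i + j) ((a : A^c) *: x).
Proof.
by move=> /homog_kerP hx ha; apply/homog_kerP; rewrite linearZ; apply: dgm_act.
Qed.

Fact ker_leibniz i (x : ker p) (a : A) : homog ker_dgs i x ->
  dg_d ker_dgs ((a : A^c) *: x) =
    (a : A^c) *: dg_d ker_dgs x + ((dg_d (dga_dg A) a : A^c) *: x) *~ zsign i.
Proof.
move=> /homog_kerP hx; apply: (@ker_incl_inj _ _ _ p).
by rewrite raddfD raddfMz; apply: dgm_leibniz.
Qed.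

Definition dg_ker : dgModule A := DgModule ker_act ker_leibniz.

Lemma dg_ker_homogP i (x : dg_ker) :
  homog (dgm_dg dg_ker) i x <-> homog (dgm_dg M) i (ker_incl p x).
Proof. exact: homog_kerP. Qed.

Lemma dg_ker_dE (x : dg_ker) :
  ker_incl p (dg_d (dgm_dg dg_ker) x) = dg_d (dgm_dg M) (ker_incl p x).
Proof. by []. Qed.

End Kernel.

(** * Scalars of k and bases of cohomology over k *)

Section Base.
Variables (k : fieldType) (A : dgAlgebra k).

Lemma dga_d1 : dg_d (dga_dg A) 1 = 0.
Proof.
have := dga_leibniz 1 (dga_one A); rewrite !mulr1 mul1r /= mulr1z => /eqP.
by rewrite -[X in X == _]addr0 (inj_eq (addrI _)) eq_sym => /eqP.
Qed.

Lemma dga_homogA (l : k) : homog (dga_dg A) 0 (l%:A : A).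
Proof. by rewrite /homog dga_prZ dga_one. Qed.

Lemma dga_dA (l : k) : dg_d (dga_dg A) (l%:A : A) = 0.
Proof. by rewrite dga_dZ dga_d1 scaler0. Qed.

Section KAction.
Variable X : dgModule A.

Definition kscale (l : k) (x : X) : X := ((l%:A : A) : A^c) *: x.

Lemma kscale1 x : kscale 1 x = x.
Proof. by rewrite /kscale scale1r; apply: scale1r. Qed.

Lemma kscale0 x : kscale 0 x = 0.
Proof. by rewrite /kscale scale0r; apply: scale0r. Qed.

Lemma kscaleA l m x : kscale l (kscale m x) = kscale (m * l) x.
Proof.
rewrite /kscale scalerA; congr (_ *: x).
by rewrite -[LHS]/((m%:A : A) * l%:A) -scalerAl mul1r scalerA.
Qed.

Lemma kscaleN l x : kscale (- l) x = - kscale l x.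
Proof. by rewrite /kscale scaleNr; apply: scaleNr. Qed.

Lemma kscaleD l x y : kscale l (x + y) = kscale l x + kscale l y.
Proof. exact: scalerDr. Qed.

Lemma kscale_sum l (I : Type) (s : seq I) (F : I -> X) :
  kscale l (\sum_(i <- s) F i) = \sum_(i <- s) kscale l (F i).
Proof. exact: scaler_sumr. Qed.

Lemma kscale_homog i l x :
  homog (dgm_dg X) i x -> homog (dgm_dg X) i (kscale l x).
Proof.
by move=> hx; rewrite -[i]addr0; apply: dgm_act => //; apply: dga_homogA.
Qed.

Lemma kscale_d i l x : homog (dgm_dg X) i x ->
  dg_d (dgm_dg X) (kscale l x) = kscale l (dg_d (dgm_dg X) x).
Proof.
by move=> hx; rewrite /kscale (dgm_leibniz _ hx) dga_dA scale0r mul0rz addr0.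
Qed.

Lemma kscale_cocycle i l x :
  cocycle (dgm_dg X) i x -> cocycle (dgm_dg X) i (kscale l x).
Proof.
move=> [hx dx]; split; first exact: kscale_homog.
by rewrite (kscale_d _ hx) dx /kscale scaler0.
Qed.

Lemma kscale_coboundary i l x :
  coboundary (dgm_dg X) i x -> coboundary (dgm_dg X) i (kscale l x).
Proof.
move=> [y hy <-]; exists (kscale l y); first exact: kscale_homog.
exact: kscale_d hy.
Qed.

Variable c : int.

(* Linear independence over k, generation and bases in H^c(X), expressed on
   representing cocycles. *)
Definition H_independent (B : X -> Prop) : Prop :=
  forall (s : seq X) (l : X -> k), uniq s -> (forall b, b \in s -> B b) ->
    coboundary (dgm_dg X) c (\sum_(b <- s) kscale (l b) b) ->
    forall b, b \in s -> l b = 0.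

Definition H_span (B : X -> Prop) (z : X) : Prop :=
  exists s : seq X, exists2 l : X -> k, (forall b, b \in s -> B b) &
    coboundary (dgm_dg X) c (z - \sum_(b <- s) kscale (l b) b).

Definition H_basis (B : X -> Prop) : Prop :=
  [/\ forall b, B b -> cocycle (dgm_dg X) c b,
      H_independent B &
      forall z, cocycle (dgm_dg X) c z -> H_span B z].

(** In a relation involving z, a nonzero coefficient of z could be divided out, which would put z in
    the span of B. *)
Lemma H_independent_insert B z : H_independent B -> ~ H_span B z ->
  H_independent (fun b => B b \/ b = z).
Proof.
move=> Bi zB s l us sB sb.
have sum_in : forall t : seq X, {subset t <= s} -> z \notin t ->
    forall b, b \in t -> B b.
  move=> t ts zt b bt; case: (sB _ (ts _ bt)) => // bz.
  by rewrite -bz bt in zt.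
case: (boolP (z \in s)) => zs; last by apply: Bi => //; apply: sum_in.
pose t := rem z s.
have zt : z \notin t by rewrite mem_rem_uniqF.
have ts : {subset t <= s} by apply: mem_rem.
have ut : uniq t by apply: rem_uniq.
have sE : \sum_(b <- s) kscale (l b) b =
    kscale (l z) z + \sum_(b <- t) kscale (l b) b.
  by rewrite (perm_big _ (perm_to_rem zs)) big_cons.
have lz : l z = 0.
  apply/eqP/negPn/negP => lz; apply: zB.
  exists t, (fun b => - (l b / l z)); first exact: sum_in.
  have := kscale_coboundary (l z)^-1 sb.
  rewrite sE kscaleD kscaleA divff // kscale1.
  congr coboundary; congr (_ + _); rewrite kscale_sum -sumrN.
  apply: eq_bigr => b _. by rewrite kscaleA kscaleN opprK.
have tl : forall b, b \in t -> l b = 0.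
  apply: Bi => //; first exact: sum_in.
  by rewrite sE lz kscale0 add0r in sb.
move=> b bs; have [->//|bz] := eqVneq b z.
by apply: tl; rewrite /t (rem_filter z us) mem_filter /= bz.
Qed.

(** Zorn's lemma for independent sets of cocycles; a maximal one spans, since otherwise a missing
    cocycle could be inserted. *)
Lemma H_basis_exists : exists B : X -> Prop, H_basis B.
Proof.
pose P (B : X -> Prop) :=
  (forall b, B b -> cocycle (dgm_dg X) c b) /\ H_independent B.
have [F FP Ft|B [[BZ Bi] Bmax]] := @classical_sets.Zorn_bigcup X P.
  split=> [b [C FC Cb]|s l us sF sb]; first exact: (FP C FC).1.
  case: s us sF sb => [//|b0 s] us sF sb.
  (* A relation involves finitely many elements, so a single member of the chain contains them
     all. *)
  have [C FC Cs] : exists2 C, F C & forall b, b \in b0 :: s -> C b.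
    elim: s b0 sF {us sb} => [|b1 s IH] b0 sF.
      have [C FC Cb] := sF b0 (mem_head _ _).
      by exists C => // b; rewrite inE => /eqP->.
    have [|C FC Cs] := IH b1.
      by move=> b bs; apply: sF; rewrite inE bs orbT.
    have [D FD Db] := sF b0 (mem_head _ _).
    case: (Ft C D FC FD) => [CD|DC]; [exists D|exists C] => // b;
      rewrite inE => /predU1P[->|/Cs] //; [exact: CD | exact: DC].
  exact: (FP C FC).2.
exists B; split=> // z cz; apply: contrapT => zB.
have nBz : ~ B z.
  move=> Bz; apply: zB; exists [:: z], (fun=> 1).
    by move=> b; rewrite inE => /eqP->.
  by rewrite big_seq1 kscale1 subrr; apply: coboundary0.
apply: (Bmax (fun b => B b \/ b = z)).
  split=> [b Bb|/(_ z (or_intror erefl))//]; by left.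
by split=> [b [/BZ//|->//]|]; apply: H_independent_insert.
Qed.

End KAction.
End Base.

(** * Covers by cells *)

Lemma shift_coboundary (k : fieldType) (A : dgAlgebra k) (M : dgModule A) m i
    (z : M) :
  coboundary (dgm_dg M) (i - m) z -> coboundary (dgm_dg (shift M m)) i z.
Proof.
move=> [y hy yE]; exists (y *~ zsign m).
  by apply: homogMz; rewrite shift_homog addrAC.
by rewrite shift_d raddfMz /= yE mulrz_zsignK.
Qed.

Lemma shift_cocycle (k : fieldType) (A : dgAlgebra k) (M : dgModule A) m i
    (z : M) :
  cocycle (dgm_dg (shift M m)) i z -> cocycle (dgm_dg M) (i - m) z.
Proof.
move=> [hz dz]; split; first by rewrite shift_homog in hz.
by rewrite -(mulrz_zsignK (dg_d _ z) m) -shift_d dz mul0rz.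
Qed.

Section Cells.
Variables (k : fieldType) (A : dgAlgebra k).
Implicit Types (M N X : dgModule A).

Fact orbit_map_linear X (z : X) :
  linear (fun a : right_regular A => (a : A^c) *: z).
Proof.
by move=> s a b; rewrite scalerDl -[s *: a]/((s : A^c) * a) -scalerA.
Qed.

Definition orbit_map X (z : X) : {linear right_regular A -> X} :=
  mk_linear (orbit_map_linear z).

Lemma orbit_mapE X (z : X) a : orbit_map z a = (a : A^c) *: z.
Proof. by []. Qed.

Lemma linear_right_regular X (f : {linear right_regular A -> X}) a :
  f a = (a : A^c) *: f (1 : A).
Proof.
by rewrite -linearZ; congr (f _); rewrite -[RHS]/((1 : A) * a) mul1r.
Qed.

(** Evaluation at 1 identifies Hom(A, X) with X. *)
Lemma hom_exact_at_free X n :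
  Hzero (dgm_dg X) n -> hom_exact_at (right_regular A) X n.
Proof.
move=> X0 f hf f0; have [|w hw wE] := X0 (f (1 : A)).
  split; first by rewrite -[n]add0r; apply/hf/dga_one.
  by rewrite (hom_d0E f0) [dg_d _ _]dga_d1 raddf0 mul0rz.
exists (orbit_map w) => [i a ha|a].
  by rewrite addrC; apply: dgm_act.
rewrite /hom_d !orbit_mapE (dgm_leibniz _ hw) addrK wE.
by rewrite -linear_right_regular.
Qed.

Lemma orbit_map_chain X i (z : X) : cocycle (dgm_dg X) i z ->
  chain_map (orbit_map z : {linear shift (right_regular A) i -> X}).
Proof.
move=> [hz dz]; apply: chain_map_intro => [j a|a].
  by rewrite shift_homog => ha; rewrite -[j](subrKC i); apply: dgm_act.
rewrite /= (dgm_leibniz _ hz) dz scaler0 add0r.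
by rewrite -scalerMzl.
Qed.

Lemma idfun_chain X : chain_map (idfun : {linear X -> X}).
Proof. by apply: chain_map_intro. Qed.

(* The contractible module mapping onto X. *)
Definition path_object X : dgModule A := fiber (idfun_chain X).

Fact path_fst_linear X : linear (fun x : path_object X => x.1).
Proof. by []. Qed.

Definition path_fst X : {linear path_object X -> X} :=
  mk_linear (@path_fst_linear X).

Lemma path_fst_chain X : chain_map (path_fst X).
Proof. by apply: chain_map_intro => [i x /fiber_homogP[]|]. Qed.

Fact path_contract_linear X :
  linear (fun x : path_object X => (x.2, 0) : path_object X).
Proof. by move=> a x y; apply: pair_ext => //=; rewrite scaler0 addr0. Qed.

Lemma hom_exact_at_path X N n : hom_exact_at (path_object X) N n.
Proof.
apply: (@hom_exact_at_contractible _ _ _ _ _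
  (mk_linear (@path_contract_linear X))).
  move=> i x /fiber_homogP[_ hx]; apply/fiber_homogP; split=> //.
  exact: homog0.
move=> x; apply: pair_ext; first by rewrite /= addrC subrK.
by rewrite /= raddf0 subr0 addr0.
Qed.

Lemma path_acyclic X : acyclic (path_object X).
Proof.
apply: fiber_acyclic; split; first exact: idfun_chain.
  by [].
by move=> i w cw; exists w => //; rewrite subrr; apply: coboundary0.
Qed.

End Cells.

Section CellCover.
Variables (k : fieldType) (A : dgAlgebra k) (X : dgModule A) (c : int).

Definition cover_basis : X -> Prop := sval (cid (H_basis_exists X c)).

Lemma cover_basisP : H_basis c cover_basis.
Proof. by rewrite /cover_basis; case: cid. Qed.

(* All cocycles of degree > c, but only a basis of H^c: this keeps H^c(cover)
   from growing, so that the kernel of the cover has no H^c. *)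
Definition is_cell (g : int * X) : Prop :=
  cocycle (dgm_dg X) g.1 g.2 /\ (c < g.1 \/ g.1 = c /\ cover_basis g.2).

Definition cell := {g : int * X | `[< is_cell g >]}.

Lemma cellP (g : cell) : is_cell (val g).
Proof. exact: (asboolW (valP g)). Qed.

Definition cover_part (o : option cell) : dgModule A :=
  if o is Some g then shift (right_regular A) (val g).1 else path_object X.

Definition cell_cover : dgModule A := dg_dsum cover_part.

Definition cover_part_map (o : option cell) : {linear cover_part o -> X} :=
  match o with
  | Some g => orbit_map (val g).2
  | None => path_fst X
  end.

Definition cover_map : {linear cell_cover -> X} := dg_copair cover_part_map.

Lemma cover_map_path x : cover_map (dsum_inj cover_part None x) = x.1.
Proof. exact: dg_copair_inj. Qed.

Lemma cover_map_cell (g : cell) (a : A) :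
  cover_map (dsum_inj cover_part (Some g) a) = (a : A^c) *: (val g).2.
Proof. exact: dg_copair_inj. Qed.

Lemma cover_map_chain : chain_map cover_map.
Proof.
split.
  apply: dg_copair_deg => -[g|]; last exact: (path_fst_chain X).1.
  by apply: (orbit_map_chain _).1; case: (cellP g).
apply: (dsum_ext (f := mk_additive (hom_d_additive 0 cover_map)) (g := \0)).
move=> o v.
change (hom_d 0 cover_map (dsum_inj cover_part o v) = 0).
rewrite /hom_d dg_dsum_d_inj !dg_copair_inj.
case: o v => [g|] v; last exact: (path_fst_chain X).2.
by apply: (orbit_map_chain _).2; case: (cellP g).
Qed.

(** A cell of degree i contributes H^(n + i)(N), with i >= c; the contractible summand contributes
    nothing. *)
Lemma hom_exact_at_cover (N : dgModule A) n :
  (forall j, c + n <= j -> Hzero (dgm_dg N) j) -> hom_exact_at cell_cover N n.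
Proof.
move=> N0; apply: hom_exact_at_dsum => -[g|]; last exact: hom_exact_at_path.
apply: hom_exact_at_shift; apply: hom_exact_at_free; apply: N0.
rewrite addrC lerD2l.
by case: (cellP g) => _ [/ltW|[-> _]].
Qed.

(** The contractible summand already hits everything; cells are there only to lift cocycles to
    cocycles. *)
Lemma cover_map_surj i y : homog (dgm_dg X) i y ->
  exists2 x : cell_cover, homog (dgm_dg cell_cover) i x & cover_map x = y.
Proof.
move=> hy; exists (dsum_inj cover_part None (y, 0)); last exact: cover_map_path.
apply: dg_dsum_inj_homog; apply/fiber_homogP; split=> //; exact: homog0.
Qed.

Lemma cover_map_coboundary_lift i y : coboundary (dgm_dg X) i y ->
  exists2 x : cell_cover, cocycle (dgm_dg cell_cover) i x & cover_map x = y.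
Proof.
move=> [u /cover_map_surj[w hw <-] <-]; exists (dg_d (dgm_dg cell_cover) w).
  by rewrite -[X in cocycle _ X](subrK 1); apply: d_cocycle.
by rewrite -(chain_mapP cover_map_chain).2.
Qed.

Definition cell_elt (g : cell) : cell_cover :=
  dsum_inj cover_part (Some g) (1 : A).

Lemma cell_elt_cocycle g : cocycle (dgm_dg cell_cover) (val g).1 (cell_elt g).
Proof.
split; last first.
  by rewrite dg_dsum_d_inj shift_d [dg_d _ _]dga_d1 mul0rz raddf0.
by apply: dg_dsum_inj_homog; rewrite shift_homog subrr; apply: dga_one.
Qed.

Lemma cover_map_cell_elt g : cover_map (cell_elt g) = (val g).2.
Proof. by rewrite cover_map_cell; apply: scale1r. Qed.

Lemma mk_cell g : is_cell g -> exists h : cell, val h = g.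
Proof. by move=> /asboolP hg; exists (Sub g hg). Qed.

Lemma cover_map_kscale l x : cover_map (kscale l x) = kscale l (cover_map x).
Proof. exact: linearZ. Qed.

(** Below c a cocycle is a coboundary, and a primitive can be lifted. Above c it is the image of the
    generator of its own cell. In degree c it is a combination of basis elements up to a
    coboundary. *)
Lemma cover_map_cocycle_lift (X0 : forall i, i < c -> Hzero (dgm_dg X) i) i y :
  cocycle (dgm_dg X) i y ->
  exists2 x : cell_cover, cocycle (dgm_dg cell_cover) i x & cover_map x = y.
Proof.
move=> cy; case: (ltgtP i c) => [ic|ci|ic].
- by apply: cover_map_coboundary_lift; apply: X0.
- have [|g gE] := @mk_cell (i, y); first by split=> //; left.
  exists (cell_elt g); last by rewrite cover_map_cell_elt gE.
  by have := cell_elt_cocycle g; rewrite gE.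
rewrite {i}ic in cy *; have [Bc _ Bs] := cover_basisP.
have [s [l sB sb]] := Bs y cy.
have [x0 cx0 x0E] := cover_map_coboundary_lift sb.
have [x1 cx1 x1E] : exists2 x : cell_cover, cocycle (dgm_dg cell_cover) c x &
    cover_map x = \sum_(b <- s) kscale (l b) b.
  elim: s sB {sb x0E} => [|b s IH] sB.
    by exists 0; [apply: cocycle0 | rewrite big_nil raddf0].
  have [b' b's|x cx xE] := IH; first by apply: sB; rewrite inE b's orbT.
  have Bb : cover_basis b by apply: sB; rewrite mem_head.
  have [|g gE] := @mk_cell (c, b); first by split; [apply: Bc | right].
  exists (kscale (l b) (cell_elt g) + x).
    apply: cocycleD => //; apply: kscale_cocycle.
    by have := cell_elt_cocycle g; rewrite gE.
  by rewrite linearD cover_map_kscale cover_map_cell_elt gE big_cons xE.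
exists (x0 + x1); first exact: cocycleD.
by rewrite linearD x0E x1E subrK.
Qed.

Hypothesis A_coconn : coconnective A.
Hypothesis A_H0 : H0_is_base A.

Lemma cell_coboundary (g : cell) i z : i < (val g).1 ->
  cocycle (dgm_dg (cover_part (Some g))) i z ->
  coboundary (dgm_dg (cover_part (Some g))) i z.
Proof.
move=> ig cz; apply: shift_coboundary; apply: A_coconn.
  by rewrite subr_lt0.
exact: (shift_cocycle (M := right_regular A) cz).
Qed.

Lemma cell_ge g : c <= (val (g : cell)).1.
Proof. by case: (cellP g) => _ [/ltW|[-> _]]. Qed.

Lemma cover_Hzero i : i < c -> Hzero (dgm_dg cell_cover) i.
Proof.
move=> ic z /dg_dsum_cocycleP cz; apply: dg_dsum_coboundary => -[g|].
  by apply: cell_coboundary => //; apply: lt_le_trans (cell_ge g).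
exact: (path_acyclic (cz None)).
Qed.

(** H^c of a cell is H^0(A) = k if the cell has degree c, and a negative cohomology group of A
    otherwise. The clause for z = 0 makes the family of scalars finitely supported. *)
Lemma cell_scalar g z : cocycle (dgm_dg (cover_part (Some g))) c z ->
  exists l : k, [/\ coboundary (dgm_dg (cover_part (Some g))) c (z - l%:A),
    (val g).1 != c -> l = 0 & z = 0 -> l = 0].
Proof.
move=> cz; have [z0|z0] := pselect (z = 0).
  by exists 0; split=> //; rewrite z0 scale0r subr0; apply: coboundary0.
have [gc|gc] := eqVneq (val g).1 c; last first.
  exists 0; split=> //; rewrite scale0r subr0; apply: cell_coboundary => //.
  by rewrite lt_neqAle eq_sym gc cell_ge.
have [|l lz] := A_H0.2 z.
  rewrite -(subrr c) -{2}gc.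
  exact: (shift_cocycle (M := right_regular A) cz).
exists l; split=> //; apply: (@shift_coboundary _ _ (right_regular A)).
by rewrite gc subrr.
Qed.

(** Up to a coboundary z is a k-combination w of generators of cells of degree c. Its image is the
    same combination of basis elements of H^c(X), so all coefficients vanish. *)
Lemma cover_map_coboundary_reflect z : cocycle (dgm_dg cell_cover) c z ->
  coboundary (dgm_dg X) c (cover_map z) -> coboundary (dgm_dg cell_cover) c z.
Proof.
move=> /dg_dsum_cocycleP cz bz.
have /choice[l lP] : forall g, exists l : k,
  [/\ coboundary (dgm_dg (cover_part (Some g))) c (z (Some g) - l%:A),
    (val g).1 != c -> l = 0 & z (Some g) = 0 -> l = 0].
  by move=> g; apply: cell_scalar.
have [s us zs] := dsum_supp z.
pose wf o : cover_part o :=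
  if o is Some g then (l g)%:A : A else 0.
have ws o : o \notin s -> wf o = 0.
  by case: o => //= g /zs zg; have [_ _ ->//] := lP g; exact: (scale0r (1 : A)).
pose w : cell_cover := Dsum (ex_intro _ s ws).
have bzw : coboundary (dgm_dg cell_cover) c (z - w).
  apply: dg_dsum_coboundary => -[g|]; first by have [] := lP g.
  by apply: path_acyclic; rewrite dsumB /= subr0; apply: (cz None).
suff l0 g : l g = 0.
  rewrite (_ : z = z - w) //; apply: dsumP => -[g|]; rewrite dsumB /= ?subr0 //.
  by rewrite l0 scale0r subr0.
have bw : coboundary (dgm_dg X) c (cover_map w).
  rewrite -[w](subKr z) linearB; apply: coboundaryB => //.
  exact: chain_map_coboundary cover_map_chain bzw.
have [gc|gc] := eqVneq (val g).1 c; last by have [_ ->] := lP g.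
case: (boolP (Some g \in s)) => gs; last first.
  by have [_ _ ->] := lP g; last exact: zs.
(* In degree c a cell is determined by its element of X, so [t] has no repetition. *)
pose s' := [seq h <- pmap id s | (val h).1 == c].
pose t := [seq (val h).2 | h <- s'].
(* [H_independent] wants coefficients indexed by elements of X: b is sent back to the cell (c, b),
   and to 0 if there is none. *)
pose l' b := if insub (c, b) is Some h then l h else 0.
have l'E h : (val h).1 = c -> l' (val h).2 = l h.
  by move=> hc; rewrite /l' -hc -surjective_pairing valK.
have gs' : g \in s' by rewrite mem_filter gc eqxx mem_pmap map_id.
have [_ Bi _] := cover_basisP.
rewrite -(l'E _ gc); apply: (Bi t) => //; last by apply: map_f.
- rewrite map_inj_in_uniq ?filter_uniq //.
    by apply: (@pmap_uniq _ _ id Some) => //; case.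
  move=> h1 h2; rewrite !mem_filter => /andP[/eqP e1 _] /andP[/eqP e2 _] e.
  by apply: val_inj; apply: pair_ext => //; rewrite e1 e2.
- move=> b /mapP[h]; rewrite mem_filter => /andP[/eqP hc _] ->.
  by case: (cellP h) => _ [|[]//]; rewrite hc ltxx.
move: bw; congr coboundary.
rewrite /cover_map /dg_copair /= (dsum_copair_funE _ us) // big_map.
rewrite big_filter.
(* The contractible component of w and its cells of degree other than c contribute zero, which
   leaves the sum over [t]. *)
elim: (s) => [|[h|] r IH]; rewrite ?big_nil //= !big_cons IH /=; last first.
  by rewrite add0r.
have [hc|hc] := eqVneq (val h).1 c; first by rewrite (l'E _ hc).
by have [_ -> // _] := lP h; rewrite -[X in X + _]/(kscale 0 _) kscale0 add0r.
Qed.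

(** The long exact sequence by hand: a primitive w in the cover has a cocycle as image; subtracting
    from w a cocycle with the same image moves the primitive into the kernel. *)
Lemma cover_ker_Hzero (X0 : forall i, i < c -> Hzero (dgm_dg X) i) i :
  i < c + 1 -> Hzero (dgm_dg (dg_ker cover_map_chain)) i.
Proof.
rewrite ltzD1 => ic z cz.
have [w hw wE] : coboundary (dgm_dg cell_cover) i (ker_incl cover_map z).
  have cz' : cocycle (dgm_dg cell_cover) i (ker_incl cover_map z).
    case: cz => /dg_ker_homogP hz dz; split=> //.
    by rewrite -(dg_ker_dE (p_chain := cover_map_chain)) dz raddf0.
  move: ic cz'; rewrite le_eqVlt => /predU1P[->|ic]; last exact: cover_Hzero.
  move=> cz'; apply: cover_map_coboundary_reflect => //.
  by rewrite ker_inclP; apply: coboundary0.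
have [|w' [hw' dw'] w'E] := @cover_map_cocycle_lift X0 (i - 1) (cover_map w).
  have [ph pd] := chain_mapP cover_map_chain.
  by split; [apply: ph | rewrite pd wE ker_inclP].
have [|y yE] := @ker_lift _ _ _ cover_map (w - w').
  by rewrite linearB w'E subrr.
exists y; first by apply/dg_ker_homogP; rewrite yE; apply: homogB.
apply: (@ker_incl_inj _ _ _ cover_map).
rewrite dg_ker_dE yE (raddfB (dg_d (dgm_dg cell_cover))).
by rewrite wE dw' subr0.
Qed.

End CellCover.

(** * Totalization *)

(** The sign identity by which the obstruction in [tot_extend_step] is a cocycle. *)
Lemma zsign_cancel (V : zmodType) (a b c : V) i :
  (a + b) *~ - zsign i + (b + c *~ zsign i) *~ zsign i
  - (a + - c *~ zsign i) *~ - zsign i = 0.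
Proof.
case: (zsignP i) => ->; rewrite ?opprK ?mulrN1z !mulr1z.
  rewrite mulr1n (addrC a b) opprD [- b - a + _]addrACA addNr add0r.
  by rewrite addrACA addNr add0r subrr.
by rewrite opprK opprB (addrC c) addrA addrK subrr.
Qed.

(* Total complex of ... -> F 2 -> F 1 -> F 0, where F j.+1 -> F j factors as
   F j.+1 -> K j.+1 -> F j; an element of F j of degree i gets degree i - j. *)
Section Total.
Variables (k : fieldType) (A : dgAlgebra k) (K F : nat -> dgModule A).
Variable p : forall j, {linear F j -> K j}.
Variable e : forall j, {linear K j.+1 -> F j}.
Hypothesis p_chain : forall j, chain_map (p j).
Hypothesis e_chain : forall j, chain_map (e j).
Hypothesis pe0 : forall j x, p j (e j x) = 0.

Definition tot_bd j : {linear F j.+1 -> F j} := e j \o p j.+1.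

Lemma tot_bdE j x : tot_bd j x = e j (p j.+1 x).
Proof. by []. Qed.

Lemma tot_bd_bd j x : tot_bd j (tot_bd j.+1 x) = 0.
Proof. by rewrite !tot_bdE pe0 raddf0. Qed.

Lemma tot_bd_homog j i x :
  homog (dgm_dg (F j.+1)) i x -> homog (dgm_dg (F j)) i (tot_bd j x).
Proof.
move=> hx; apply: (chain_mapP (e_chain j)).1.
exact: (chain_mapP (p_chain _)).1.
Qed.

Lemma tot_bd_d j x :
  dg_d (dgm_dg (F j)) (tot_bd j x) = tot_bd j (dg_d (dgm_dg (F j.+1)) x).
Proof.
by rewrite !tot_bdE (chain_mapP (e_chain j)).2 (chain_mapP (p_chain _)).2.
Qed.

Definition tot_part (j : nat) : dgModule A := shift (F j) (- j%:Z).

Lemma tot_part_d j x :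
  dg_d (dgm_dg (tot_part j)) x = dg_d (dgm_dg (F j)) x *~ zsign j.
Proof. by rewrite shift_d zsignN. Qed.

(** The sign (-1)^j from the shift makes [tot_bd] anticommute with the differentials; as [tot_bd]
    squares to zero, the Maurer-Cartan equation follows. *)
Lemma tot_bd_part_d j x :
  tot_bd j (dg_d (dgm_dg (tot_part j.+1)) x) =
  - dg_d (dgm_dg (tot_part j)) (tot_bd j x).
Proof.
have zS : zsign j.+1 = - zsign j by rewrite -addn1 PoszD zsignS.
by rewrite !tot_part_d [LHS]raddfMz tot_bd_d zS mulrNz.
Qed.

Notation S := (dg_dsum tot_part).

Fact tot_tau_fin (x : S) : exists s : seq nat, forall j, j \notin s ->
  tot_bd j (x j.+1) = 0 :> tot_part j.
Proof.
have [s xs] := dsum_fin x; exists (map predn s) => j js.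
rewrite xs ?raddf0 //; apply: contra js => js.
by apply/mapP; exists j.+1.
Qed.

Definition tot_tau_fun (x : S) : S := Dsum (tot_tau_fin x).

Fact tot_tau_linear : linear tot_tau_fun.
Proof. by move=> a x y; apply: dsumP => j; apply: (linearP (tot_bd j)). Qed.

Definition tot_tau : {linear S -> S} := mk_linear tot_tau_linear.

Lemma tot_tauE x j : tot_tau x j = tot_bd j (x j.+1).
Proof. by []. Qed.

Fact tot_tau_deg : hom_deg 1 tot_tau.
Proof.
move=> i x /dg_dsum_homogP hx; apply/dg_dsum_homogP => j.
rewrite tot_tauE shift_homog; apply: tot_bd_homog.
by have := hx j.+1; rewrite shift_homog; congr homog; lia.
Qed.

Fact tot_tau_mc x :
  dg_d (dgm_dg S) (tot_tau x) + tot_tau (dg_d (dgm_dg S) x)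
  + tot_tau (tot_tau x) = 0.
Proof.
apply: dsumP => j; rewrite !dsumD !tot_tauE !dg_dsum_dE tot_bd_bd addr0.
by rewrite tot_bd_part_d tot_tauE subrr.
Qed.

Definition tot : dgModule A := twist tot_tau_deg tot_tau_mc.

Definition tot_inj j : {linear tot_part j -> tot} := dsum_inj tot_part j.

Lemma tot_dE (x : tot) j : (dg_d (dgm_dg tot) x : S) j =
  dg_d (dgm_dg (tot_part j)) ((x : S) j) + tot_bd j ((x : S) j.+1).
Proof. by []. Qed.

Lemma tot_homogP i (x : tot) : homog (dgm_dg tot) i x <->
  forall j, homog (dgm_dg (tot_part j)) i ((x : S) j).
Proof. exact: dg_dsum_homogP. Qed.

Lemma tot_inj_homog i j x :
  homog (dgm_dg (tot_part j)) i x -> homog (dgm_dg tot) i (tot_inj j x).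
Proof. exact: dg_dsum_inj_homog. Qed.

Lemma tot_inj_same j x : (tot_inj j x : S) j = x.
Proof. exact: dsum_inj_same. Qed.

Lemma tot_inj_neq j l x : j != l -> (tot_inj j x : S) l = 0.
Proof. exact: dsum_inj_neq. Qed.

Lemma tot_d_inj0 x : dg_d (dgm_dg tot) (tot_inj 0 x) =
  tot_inj 0 (dg_d (dgm_dg (tot_part 0)) x).
Proof.
rewrite twist_dE dg_dsum_d_inj -[RHS]addr0; congr (_ + _).
by apply: dsumP => l; rewrite tot_tauE tot_inj_neq // raddf0.
Qed.

Lemma tot_d_injS j x : dg_d (dgm_dg tot) (tot_inj j.+1 x) =
  tot_inj j.+1 (dg_d (dgm_dg (tot_part j.+1)) x) + tot_inj j (tot_bd j x).
Proof.
rewrite twist_dE dg_dsum_d_inj; congr (_ + _); apply: dsumP => l.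
rewrite tot_tauE; have [<-|jl] := eqVneq j l; first by rewrite !tot_inj_same.
by rewrite !tot_inj_neq // raddf0.
Qed.

Section Extension.
Variables (N : dgModule A) (s : int) (g : {linear tot -> N}).
Hypothesis g_deg : hom_deg (s + 1) g.
Hypothesis g0 : forall x, hom_d (s + 1) g x = 0.
Hypothesis N_exact : forall j : nat, hom_exact_at (F j.+1) N (s - j%:Z).

(** What column j + 1 needs to know about column j: on boundaries the contribution of column j - 1
    vanishes, so the condition has the same form for every j. *)
Definition tot_good j (h : {linear tot_part j -> N}) : Prop :=
  hom_deg s h /\
  forall x, hom_d s h (tot_bd j x) = g (tot_inj j (tot_bd j x)).

(** The equation D H = g, read on column j + 1, prescribes D h' in terms of g and h. The prescribed
    map is a cocycle because [h] is good, and exactness provides h'. *)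
Lemma tot_extend_step j (h : {linear tot_part j -> N}) : tot_good h ->
  exists2 h' : {linear tot_part j.+1 -> N}, tot_good h' &
    forall x, hom_d s h' x = g (tot_inj j.+1 x) + h (tot_bd j x) *~ zsign s.
Proof.
move=> [hh hE].
pose f x := g (tot_inj j.+1 x) + h (tot_bd j x) *~ zsign s.
have fL : linear f.
  move=> a x y; rewrite /f !linearP /= mulrzDl scalerDr -scalerMzr !addrA.
  by congr (_ + _); rewrite addrAC.
(* The shift by -(j + 1) turns degree s + 1 into s - j. *)
have ex : hom_exact_at (tot_part j.+1) N (s + 1).
  by apply: hom_exact_at_shift; have := @N_exact j; congr hom_exact_at; lia.
have [||h' hh' h'E] := ex (mk_linear fL).
- move=> i x hx; apply: homogD; first by apply: g_deg; apply: tot_inj_homog.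
  apply: homogMz; rewrite addrCA addrC; apply: hh; rewrite shift_homog.
  apply: tot_bd_homog; move: hx; rewrite shift_homog; congr homog; lia.
- move=> x; rewrite -[mk_linear fL : _ -> _]/f.
  have hd := hE x; move/eqP: hd; rewrite /hom_d subr_eq => /eqP hd.
  rewrite /hom_d /f [dg_d _ (_ + _)]raddfD [dg_d _ (_ *~ _)]raddfMz.
  rewrite (hom_d0E g0) tot_d_injS [g (_ + _)]raddfD [in LHS]hd.
  rewrite tot_bd_part_d [h (- _)]raddfN zsignS.
  exact: zsign_cancel.
rewrite addrK in hh' h'E; exists h' => //; split=> // x.
by rewrite h'E /= /f tot_bd_bd raddf0 mul0rz addr0.
Qed.

(* Solves D h = g on tot with prescribed restriction to F 0; the obstruction to
   passing from F j to F j.+1 is a class in H^(s - j) Hom(F j.+1, N). *)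
Lemma tot_extend (h0 : {linear tot_part 0 -> N}) :
  hom_deg s h0 -> (forall x, hom_d s h0 x = g (tot_inj 0 x)) ->
  exists h : {linear tot -> N}, [/\ hom_deg s h,
    forall x, hom_d s h x = g x & forall x, h (tot_inj 0 x) = h0 x].
Proof.
move=> hh0 h0E.
have h0_good : tot_good h0 by split=> // x; apply: h0E.
pose next j (h : {h : {linear tot_part j -> N} | tot_good h}) :=
  cid2 (tot_extend_step (svalP h)).
pose hs := fix hs j : {h : {linear tot_part j -> N} | tot_good h} :=
  if j is j'.+1 return {h : {linear tot_part j -> N} | tot_good h}
  then exist _ (s2val (next _ (hs j'))) (s2valP (next _ (hs j')))
  else exist _ h0 h0_good.
have hsS j x : hom_d s (sval (hs j.+1)) x =
    g (tot_inj j.+1 x) + sval (hs j) (tot_bd j x) *~ zsign s.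
  exact: (s2valP' (next _ (hs j)) x).
pose H : {linear tot -> N} := dg_copair (fun j => sval (hs j)).
have HE j x : H (tot_inj j x) = sval (hs j) x by apply: dg_copair_inj.
exists H; split; last exact: (HE 0).
  by apply: (@dg_copair_deg _ _ _ tot_part) => j; have [] := svalP (hs j).
apply: (dsum_ext (f := mk_additive (hom_d_additive s H)) (g := g)) => j x.
rewrite -[LHS]/(hom_d s H (tot_inj j x)) -[RHS]/(g (tot_inj j x)).
case: j x => [|j] x; rewrite /hom_d HE.
  by rewrite tot_d_inj0 (HE 0); apply: h0E.
rewrite tot_d_injS [H (_ + _)]linearD (HE j.+1) (HE j).
have := hsS j x; rewrite /hom_d => /eqP; rewrite subr_eq => /eqP ->.
by rewrite mulrzDl opprD addrA !addrK.
Qed.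

End Extension.

(** [tot_extend] with s = n - 1, exactness on column 0 providing the initial map; for column j + 1
    the degrees agree since (n - 1) - j = n - (j + 1). *)
Lemma hom_exact_at_tot (N : dgModule A) n :
  (forall j : nat, hom_exact_at (F j) N (n - j%:Z)) -> hom_exact_at tot N n.
Proof.
move=> Nex g hg g0.
have [||h0 hh0 h0E] := @hom_exact_at_shift _ _ (F 0) (- 0%:Z) N n (@Nex 0)
  (g \o tot_inj 0 : {linear tot_part 0 -> N}).
- by move=> i x hx; apply: hg; apply: tot_inj_homog.
- by move=> x; have := g0 (tot_inj 0 x); rewrite /hom_d tot_d_inj0.
have [||j|h [hh hE _]] := @tot_extend N (n - 1) g _ _ _ h0 hh0 h0E.
- by rewrite subrK.
- by rewrite subrK.
- by have := @Nex j.+1; congr hom_exact_at; lia.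
by exists h.
Qed.

Section Augmentation.
Hypothesis e_inj : forall j, injective (e j).
Hypothesis e_lift_homog : forall j i y, homog (dgm_dg (F j)) i y -> p j y = 0 ->
  exists2 x, homog (dgm_dg (K j.+1)) i x & e j x = y.
Hypothesis p_lift_homog : forall j i y, homog (dgm_dg (K j)) i y ->
  exists2 x, homog (dgm_dg (F j)) i x & p j x = y.
Hypothesis p_lift_cocycle : forall j i y, cocycle (dgm_dg (K j)) i y ->
  exists2 x, cocycle (dgm_dg (F j)) i x & p j x = y.

Definition tot_aug : {linear tot -> K 0} := p 0 \o dsum_proj tot_part 0.

Lemma tot_augE (x : tot) : tot_aug x = p 0 ((x : S) 0%N).
Proof. by []. Qed.

Lemma tot_aug_chain : chain_map tot_aug.
Proof.
have [ph pd] := chain_mapP (p_chain 0).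
apply: chain_map_intro => [i x /tot_homogP/(_ 0)|x].
  by rewrite shift_homog => hx; apply: ph; rewrite subr0 in hx.
rewrite !tot_augE tot_dE [RHS]linearD (@pe0 0) addr0 tot_part_d.
by rewrite mulr1z pd.
Qed.

Lemma tot_bd_lift_homog j i y : homog (dgm_dg (F j)) i y -> p j y = 0 ->
  exists2 x, homog (dgm_dg (F j.+1)) i x & tot_bd j x = y.
Proof.
move=> hy /(e_lift_homog hy)[u hu <-].
by have [x hx <-] := p_lift_homog hu; exists x.
Qed.

Lemma tot_bd_lift_cocycle j i y : cocycle (dgm_dg (F j)) i y -> p j y = 0 ->
  exists2 x, cocycle (dgm_dg (F j.+1)) i x & tot_bd j x = y.
Proof.
move=> [hy dy] /(e_lift_homog hy)[u hu uy].
have [|x cx xu] := @p_lift_cocycle j.+1 i u; last first.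
  by exists x; rewrite // tot_bdE xu.
split=> //; apply: (@e_inj j).
by rewrite -(chain_mapP (e_chain j)).2 uy dy raddf0.
Qed.

Lemma tot_bd_eq0 j x : tot_bd j x = 0 -> p j.+1 x = 0.
Proof. by move=> x0; apply: (@e_inj j); rewrite raddf0. Qed.

(* z is pushed to higher and higher j by subtracting coboundaries; the process
   stops because a cocycle of K j lifts to a cocycle of F j. *)
Lemma tot_coboundary d j i (z : tot) : cocycle (dgm_dg tot) i z ->
  (forall l, (l < j)%N -> (z : S) l = 0) -> p j ((z : S) j) = 0 ->
  (forall l, (j + d < l)%N -> (z : S) l = 0) -> coboundary (dgm_dg tot) i z.
Proof.
elim: d j z => [|d IH] j z [hz dz] z_lt pz z_gt.
  (* Only column j is left, so its component is a cocycle. It bounds a cocycle of column j + 1, and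
     no further component appears. *)
  have dzj : dg_d (dgm_dg (tot_part j)) ((z : S) j) = 0.
    have : (dg_d (dgm_dg tot) z : S) j = 0 by rewrite dz.
    by rewrite tot_dE (z_gt j.+1) ?addn0 // raddf0 addr0.
  have czj : cocycle (dgm_dg (F j)) (i + j%:Z) ((z : S) j).
    split; first by move/tot_homogP/(_ j): hz; rewrite shift_homog opprK.
    by rewrite -(mulrz_zsignK (dg_d _ _) j) -tot_part_d dzj mul0rz.
  have [w [hw dw] wE] := tot_bd_lift_cocycle czj pz.
  exists (tot_inj j.+1 w).
    by apply: tot_inj_homog; rewrite shift_homog; move: hw; congr homog; lia.
  rewrite tot_d_injS tot_part_d dw mul0rz raddf0 add0r wE.
  apply: (@dsumP _ _ tot_part) => l.
  have [<-|jl] := eqVneq j l; first by rewrite tot_inj_same.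
  rewrite tot_inj_neq //; case: (ltngtP l j) jl => // lj _.
    by rewrite z_lt.
  by rewrite z_gt ?addn0.
have [w hw wE] : exists2 w, homog (dgm_dg (F j.+1)) (i + j%:Z) w &
    tot_bd j w = (z : S) j.
  apply: tot_bd_lift_homog => //.
  by move/tot_homogP/(_ j): hz; rewrite shift_homog opprK.
have hW : homog (dgm_dg tot) (i - 1) (tot_inj j.+1 w).
  by apply: tot_inj_homog; rewrite shift_homog; move: hw; congr homog; lia.
pose W := dg_d (dgm_dg tot) (tot_inj j.+1 w).
have bW : coboundary (dgm_dg tot) i W by exists (tot_inj j.+1 w).
pose z' : tot := z - W.
suff : coboundary (dgm_dg tot) i z'.
  by move=> bz'; rewrite -[z](subrK W); apply: coboundaryD.
have WE l : (W : S) l =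
    (tot_inj j.+1 (dg_d (dgm_dg (tot_part j.+1)) w) : S) l
    + (tot_inj j (tot_bd j w) : S) l.
  by rewrite /W tot_d_injS.
have z'E l : (z' : S) l = (z : S) l - (W : S) l by [].
have cz' : cocycle (dgm_dg tot) i z'.
  by apply: cocycleB => //; apply: coboundary_cocycle.
have z'j : (z' : S) j = 0.
  by rewrite z'E WE tot_inj_same tot_inj_neq ?eqn_leq ?ltnn // add0r wE subrr.
apply: (IH j.+1) => // [l|| l].
- rewrite ltnS leq_eqVlt => /predU1P[->//|lj].
  rewrite z'E WE z_lt // !tot_inj_neq ?addr0 ?subr0 //.
    by rewrite gtn_eqF.
  by rewrite gtn_eqF // ltnW.
(* Since z' vanishes in column j, that column of its differential reduces to [tot_bd] of the next
   component. *)
- apply: tot_bd_eq0; case: cz' => _ dz'.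
  have : (dg_d (dgm_dg tot) z' : S) j = 0 by rewrite dz'.
  by rewrite tot_dE z'j raddf0 add0r.
- move=> lj; rewrite z'E WE z_gt ?addnS -?addSn //.
  by rewrite !tot_inj_neq ?addr0 ?subr0 // ltn_eqF //; lia.
Qed.

(** For injectivity, a primitive of the image of z is lifted to column 0 and its differential
    subtracted; the augmentation of z then vanishes exactly, as [tot_coboundary] requires in column
    0. *)
Lemma tot_aug_quasi_iso : quasi_iso tot_aug.
Proof.
split; first exact: tot_aug_chain.
- move=> i z cz [y hy yE].
  have [w hw wE] := p_lift_homog hy.
  have hW : homog (dgm_dg tot) (i - 1) (tot_inj 0 w).
    by apply: tot_inj_homog; rewrite shift_homog subr0.
  pose W := dg_d (dgm_dg tot) (tot_inj 0 w).
  have bW : coboundary (dgm_dg tot) i W by exists (tot_inj 0 w).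
  have cz' : cocycle (dgm_dg tot) i (z - W).
    by apply: cocycleB => //; apply: coboundary_cocycle.
  suff : coboundary (dgm_dg tot) i (z - W).
    by move=> bz'; rewrite -[z](subrK W); apply: coboundaryD.
  have [s us zs] := dsum_supp (z - W : S).
  apply: (@tot_coboundary (\max_(l <- s) l) 0) => // [|l lm].
    rewrite -tot_augE [LHS]linearB -yE -(chain_mapP tot_aug_chain).2.
    by rewrite [tot_aug (tot_inj 0 w)]tot_augE tot_inj_same wE subrr.
  apply: zs; apply: contraTN lm => ls.
  by rewrite add0n -leqNgt; apply: leq_bigmax_seq.
move=> i w cw; have [z [hz dz] zE] := p_lift_cocycle cw.
exists (tot_inj 0 z).
  split; first by apply: tot_inj_homog; rewrite shift_homog subr0.
  by rewrite tot_d_inj0 tot_part_d dz mul0rz raddf0.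
by rewrite tot_augE tot_inj_same zE subrr; apply: coboundary0.
Qed.

End Augmentation.
End Total.

(** * The resolution *)

Lemma ker_incl_chain (k : fieldType) (A : dgAlgebra k) (M N : dgModule A)
    (p : {linear M -> N}) (p_chain : chain_map p) :
  chain_map (ker_incl p : {linear dg_ker p_chain -> M}).
Proof. by apply: chain_map_intro => [i x /dg_ker_homogP|]. Qed.

Section Resolution.
Variables (k : fieldType) (A : dgAlgebra k).
Hypothesis A_coconn : coconnective A.
Hypothesis A_H0 : H0_is_base A.
Variables (M : dgModule A) (m : int).
Hypothesis M0 : forall i, i < m -> Hzero (dgm_dg M) i.

(** The cut-off m + j rises with each kernel and compensates the shift of column j by -j: cells of
    every column have total degree at least m. *)
Fixpoint syzygy (j : nat) : dgModule A :=
  if j is j'.+1 then dg_ker (@cover_map_chain _ _ (syzygy j') (m + j'%:Z))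
  else M.

Definition syzygy_cover j : dgModule A := cell_cover (syzygy j) (m + j%:Z).

Definition syzygy_map j : {linear syzygy_cover j -> syzygy j} :=
  cover_map (syzygy j) (m + j%:Z).

Lemma syzygy_Hzero j i : i < m + j%:Z -> Hzero (dgm_dg (syzygy j)) i.
Proof.
elim: j i => [|j IH] i ij; first by apply: M0; rewrite addr0 in ij.
apply: cover_ker_Hzero => //.
by rewrite -addrA -PoszD addn1.
Qed.

Definition resolution : dgModule A :=
  tot (fun j => @cover_map_chain _ _ (syzygy j) (m + j%:Z))
      (fun j => ker_incl_chain (@cover_map_chain _ _ (syzygy j) (m + j%:Z)))
      (fun j => @ker_inclP _ _ _ (syzygy_map j)).

Definition resolution_map : {linear resolution -> M} := tot_aug _ _ _.

Lemma resolution_K_projective : K_projective resolution.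
Proof.
move=> N N0 n; apply: hom_exact_at_tot => j.
by apply: hom_exact_at_cover => l _; apply: N0.
Qed.

Lemma resolution_quasi_iso : quasi_iso resolution_map.
Proof.
apply: tot_aug_quasi_iso.
- move=> j; exact: ker_incl_inj.
- move=> j i y hy /ker_lift[x xE]; exists x => //.
  by apply/dg_ker_homogP; rewrite xE.
- move=> j i y; exact: cover_map_surj.
- move=> j i y; apply: cover_map_cocycle_lift => l; exact: syzygy_Hzero.
Qed.

(* f sends a basis cell of degree m to t and the other cells of F 0 to 0; it
   extends to the whole resolution because the remaining obstructions lie in
   H^j(A) with j > n. *)
Lemma resolution_detects (n : int) (t : A) :
  ~ Hzero (dgm_dg M) m ->
  (forall j, n < j -> Hzero (dga_dg A) j) ->
  cocycle (dga_dg A) n t -> ~ coboundary (dga_dg A) n t ->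
  exists (f : {linear resolution -> right_regular A}) (z : resolution),
    [/\ hom_deg (n - m) f, forall x, hom_d (n - m) f x = 0,
        cocycle (dgm_dg resolution) m z & ~ coboundary (dga_dg A) n (f z)].
Proof.
move=> Mm A0 [ht dt] bt.
have [BZ _ Bs] := cover_basisP M (m + 0).
(* An empty basis would force H^m(M) = 0. *)
have [b Bb] : exists b : M, cover_basis (m + 0) b.
  apply: contrapT => nB; apply: Mm; rewrite -[m]addr0 => z cz.
  have [[|b s] [l sB]] := Bs z cz; first by rewrite big_nil [z - _]subr0.
  by case: nB; exists b; apply: sB; rewrite mem_head.
have [|g gE] := @mk_cell _ _ M (m + 0) (m + 0, b).
  by split; [apply: BZ | right].
pose f0 : {linear syzygy_cover 0 -> right_regular A} :=
  orbit_map (t : right_regular A)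
    \o dsum_proj (@cover_part _ _ M (m + 0)) (Some g).
have f0E x : f0 x = (t * x (Some g) :> A) by [].
have f0_deg : @hom_deg _ _ (tot_part syzygy_cover 0) _ (n - m) f0.
  move=> i x; rewrite shift_homog => /dg_dsum_homogP/(_ (Some g)) hx.
  have := dga_mul ht (hx : homog (dga_dg A) (i - - 0 - (val g).1) (x (Some g))).
  by rewrite gE; congr homog; rewrite /=; lia.
have f0_d x : @hom_d _ _ (tot_part syzygy_cover 0) _ (n - m) f0 x = 0.
  rewrite /hom_d !f0E [dg_d _ _](dga_leibniz _ ht) dt mul0r add0r.
  rewrite tot_part_d mulr1z dg_dsum_dE /= gE /=.
  apply/eqP; rewrite subr_eq0; apply/eqP.
  (* The Leibniz sign of t, of degree n, splits into the sign of the cell, of degree m, and that of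
     the map, of degree n - m. *)
  transitivity
    ((t * dg_d (dga_dg A) (x (Some g))) *~ zsign (m + 0) *~ zsign (n - m)).
    by rewrite -mulrzA -zsignD (_ : m + 0 + (n - m) = n) //; lia.
  by congr (_ *~ _); rewrite -mulrzAr.
have [h [hh hE h0]] : exists h : {linear resolution -> right_regular A},
    [/\ hom_deg (n - m) h, forall x, hom_d (n - m) h x = 0 &
      forall x, h (tot_inj _ _ _ 0 x) = f0 x].
  (* With g = 0 a solution is a cocycle of the Hom complex that extends [f0]. *)
  apply: (tot_extend (g := \0)) f0_deg f0_d.
  - by move=> i x _; apply: homog0.
  - by move=> x; rewrite /hom_d raddf0 mul0rz subr0.
  (* The least degree involved is (m + j + 1) + (n - m - j) = n + 1, just above the top degree of
     A. *)
  - move=> j; apply: hom_exact_at_cover => l; rewrite -addn1 PoszD => lj.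
    by apply: A0; lia.
exists h, (tot_inj _ _ _ 0 (cell_elt g)); split=> //.
  have [hz dz] := cell_elt_cocycle g; rewrite gE /= in hz; split.
    by apply: tot_inj_homog; rewrite shift_homog; move: hz; congr homog; lia.
  by rewrite tot_d_inj0 tot_part_d dz mul0rz raddf0.
by rewrite h0 f0E dsum_inj_same mulr1.
Qed.

End Resolution.

(** * Comparison with an arbitrary K-projective resolution *)

Lemma Hzero_quasi_iso (k : fieldType) (A : dgAlgebra k) (M N : dgModule A)
    (p : {linear M -> N}) i : quasi_iso p ->
  Hzero (dgm_dg M) i <-> Hzero (dgm_dg N) i.
Proof.
move=> [p_chain p_inj p_surj]; split=> [M0 w cw|N0 z cz].
  have [z cz wz] := p_surj i w cw; rewrite -[w](subrK (p z)).
  by apply: coboundaryD => //; apply: chain_map_coboundary => //; apply: M0.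
by apply: p_inj => //; apply: N0; apply: chain_map_cocycle.
Qed.

(** The map y |-> (0, y) to the acyclic fiber of q is a cocycle of degree 1. A primitive of it has
    two components: a chain map h to Q and a homotopy from q h to the identity. *)
Lemma K_projective_section (k : fieldType) (A : dgAlgebra k)
    (P Q : dgModule A) (q : {linear Q -> P}) :
  K_projective P -> quasi_iso q ->
  exists2 h : {linear P -> Q}, chain_map h &
    forall i z, cocycle (dgm_dg P) i z ->
      coboundary (dgm_dg P) i (q (h z) - z).
Proof.
move=> Pproj qi; have [q_chain _ _] := qi.
pose F := fiber q_chain.
have iL : linear (fun y : P => (0, y) : F).
  by move=> a x y; apply: pair_ext; rewrite //= scaler0 addr0.
have [||h hh hE] :=
  Pproj F (fiber_acyclic (f_chain := q_chain) qi) 1 (mk_linear iL).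
- move=> i y hy; apply/fiber_homogP; split; first exact: homog0.
  by rewrite /= addrK.
- move=> y; apply: pair_ext.
    by rewrite /= raddf0 opprK addr0.
  by rewrite /= raddf0 sub0r opprK addNr.
rewrite subrr in hh hE.
have fstL : linear (fun x : F => x.1 : Q) by [].
pose h1 : {linear P -> Q} := mk_linear fstL \o h.
exists h1.
  split=> [i x hx|x]; first by have /fiber_homogP[] := hh i x hx.
  by have := congr1 fst (hE x); rewrite /hom_d /= mulr1z.
move=> i z [hz dz]; exists (h z).2.
  by have /fiber_homogP[_] := hh i z hz; rewrite addr0.
have := congr1 snd (hE z); rewrite /hom_d dz raddf0 mul0rz subr0 /= => zE.
by rewrite -[X in _ - X]zE subKr.
Qed.

Lemma first_int (P : int -> Prop) (b i : int) :
  (forall j, j < b -> ~ P j) -> P i ->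
  exists2 m, P m & forall j, j < m -> ~ P j.
Proof.
move=> Pb; have [N] := ubnP `|i - b|%N.
elim: N i => // N IH i iN Pi.
have [[j [ji Pj]]|nP] := pselect (exists j, j < i /\ P j); last first.
  by exists i => // j ji Pj; apply: nP; exists j.
apply: (IH j) => //.
have bj : b <= j by rewrite leNgt; apply/negP => /Pb.
lia.
Qed.

Theorem proposition1p3 (k : fieldType) (A : dgAlgebra k)
    (A_coconn : coconnective A)
    (A_H0 : H0_is_base A)
    (A_bounded : Hbounded_above (dga_dg A))
    (M : dgModule A)
    (M_nonzero : Hnonzero (dgm_dg M))
    (M_bounded : Hbounded_below (dgm_dg M)) :
  derived_Hom_nonzero M (right_regular A).
Proof.
have [n [t [ct bt]] A0] : exists2 n, exists t, cocycle (dga_dg A) n t /\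
    ~ coboundary (dga_dg A) n t & forall j, n < j -> Hzero (dga_dg A) j.
  have [b bA] := A_bounded.
  (* The top degree is a least degree after reflection; degree 0 starts the search, since 1 is not a
     coboundary. *)
  have [|| n n0 nA] := @first_int (fun i => ~ Hzero (dga_dg A) (- i)) (- b) 0.
  - by move=> j jb; apply; apply: bA; lia.
  - rewrite oppr0 => A00; apply/negP: (oner_neq0 k); rewrite negbK; apply/eqP.
    apply: A_H0.1; rewrite scale1r; apply: A00.
    by split; [apply: dga_one | apply: dga_d1].
  have /existsNP[t /not_implyP tP] := n0.
  exists (- n); first by exists t.
  by move=> j nj; apply: contrapT; rewrite -[j]opprK; apply: nA; lia.
have [m Mm M0] : exists2 m, ~ Hzero (dgm_dg M) m &
    forall j, j < m -> Hzero (dgm_dg M) j.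
  have [b bM] := M_bounded; have [i iM] := M_nonzero.
  have [|| m mM m0] := @first_int (fun i => ~ Hzero (dgm_dg M) i) b i => //.
    by move=> j /bM Hj; apply.
  by exists m => // j /m0; apply: contrapT.
split.
  exists (resolution M m), (resolution_map M m); split.
    exact: resolution_K_projective.
  exact: resolution_quasi_iso.
move=> P p [Pproj pi] Pac.
(* P itself is resolved: [f] then restricts along a homotopy section of the
   quasi-isomorphism [resolution P m -> P]. *)
have P0 i : i < m -> Hzero (dgm_dg P) i.
  by move=> /M0; apply: (Hzero_quasi_iso i pi).2.
have Pm : ~ Hzero (dgm_dg P) m by move=> /(Hzero_quasi_iso m pi).1.
have qi := resolution_quasi_iso A_coconn A_H0 P0.
have [f [z [f_deg f_d cz fz]]] := resolution_detects Pm A0 ct bt.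
have [h h_chain hE] := K_projective_section Pproj qi.
have [_ q_inj _] := qi; have [hh hd] := chain_mapP h_chain.
pose q := resolution_map P m; set w := h (q z).
have cqz : cocycle (dgm_dg P) m (q z).
  by apply: chain_map_cocycle => //; case: qi.
(* A primitive of f h in the Hom complex, evaluated on the cocycle q z, bounds f w. *)
have bfw : coboundary (dga_dg A) n (f w).
  have fh_deg : hom_deg (n - m) (f \o h : {linear P -> right_regular A}).
    by move=> i x /hh /f_deg.
  have [|u hu uE] := Pac _ _ fh_deg.
    by move=> x; rewrite /hom_d /= -hd; apply: f_d.
  have := hom_coboundary hu uE cqz.
  by rewrite addrC subrK.
(* The cocycles w and z are cohomologous, as q (w - z) is a coboundary and q is injective on
   cohomology; hence so are f w and f z. *)
apply: fz; rewrite -[f z](subKr (f w)); apply: coboundaryB => //.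
rewrite -linearB.
have -> : n = m + (n - m) by lia.
apply: (hom_preserves_coboundary f_deg f_d); apply: q_inj.
  by apply: cocycleB => //; apply: chain_map_cocycle.
by rewrite linearB; apply: hE.
Qed.
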